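(* Let $\Sigma$ be a cleft $L$-$\mathcal C$ bicomodule for a pure right coring extension $(\mathcal D:L)$ of $(\mathcal C:A)$, and put $T=\mathrm{End}^{\mathcal C}(\Sigma)$. (1) (Weak Structure Theorem) The functor $\mathrm{Hom}^{\mathcal C}(\Sigma,-):\mathcal M^{\mathcal C}\to\mathcal M_T$ is fully faithful. (2) (Strong Structure Theorem) The functors $-\otimes_T\Sigma:\mathcal M_T\to\mathcal M^{\mathcal C}$ and $\mathrm{Hom}^{\mathcal C}(\Sigma,-):\mathcal M^{\mathcal C}\to\mathcal M_T$ are inverse equivalences provided that there exist (finite sets of) elements $\{v_j\}\subset{}_L\mathrm{Hom}_L(\mathcal D,T)$ and $\{d_j\}\subset\mathcal D$ such that $\sum_j v_j(d_j)=1_T$.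
   Context: Corings. Fix a commutative ring $k$; all algebras are associative unital $k$-algebras. For an algebra $A$, an $A$-coring is an $A$-bimodule $\mathcal C$ with $A$-bilinear coassociative coproduct $\Delta_{\mathcal C}:\mathcal C\to\mathcal C\otimes_A\mathcal C$, $c\mapsto c^{(1)}\otimes_A c^{(2)}$, and $A$-bilinear counit $\epsilon_{\mathcal C}:\mathcal C\to A$. A right $\mathcal C$-comodule is a right $A$-module $M$ with a right $A$-linear coassociative counital coaction $M\to M\otimes_A\mathcal C$, $m\mapsto m^{[0]}\otimes_A m^{[1]}$. $\mathcal M^{\mathcal C}$ is the category of right $\mathcal C$-comodules, with hom sets $\mathrm{Hom}^{\mathcal C}(-,-)$; $\mathcal M_T$ is the category of right $T$-modules. The functor $-\otimes_T\Sigma$ (with $A$-action and coaction from $\Sigma$) is left adjoint to $\mathrm{Hom}^{\mathcal C}(\Sigma,-)$. Pure coring extensions. Let $\mathcal D$ be an $L$-coring; its coproduct and right coactions are written with lower indices, $d\mapsto d_{(1)}\otimes_L d_{(2)}$, $m\mapsto m_{[0]}\otimes_L m_{[1]}$. $(\mathcal D:L)$ is a right extension of $(\mathcal C:A)$ if $\mathcal C$ is a $\mathcal C$-$\mathcal D$ bicomodule with left regular coaction $\Delta_{\mathcal C}$ and some right $\mathcal D$-coaction $\tau_{\mathcal C}:c\mapsto c_{[0]}\otimes_L c_{[1]}$ (so the right $L$-action and $\tau_{\mathcal C}$ are left $A$-linear, and $\Delta_{\mathcal C}$ is right $\mathcal D$-colinear, $\mathcal C\otimes_A\mathcal C$ having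 coaction $\mathcal C\otimes_A\tau_{\mathcal C}$). Every right $\mathcal C$-comodule $M$ is a right $L$-module via $ml=m^{[0]}\epsilon_{\mathcal C}(m^{[1]}l)$. The extension is pure if for every right $\mathcal C$-comodule $(M,\varrho)$ the equalizer $M\xrightarrow{\varrho}M\otimes_A\mathcal C\rightrightarrows M\otimes_A\mathcal C\otimes_A\mathcal C$ of $\varrho\otimes_A\mathcal C$ and $M\otimes_A\Delta_{\mathcal C}$ in $\mathcal M_L$ is preserved by $-\otimes_L\mathcal D\otimes_L\mathcal D$. In this case every right $\mathcal C$-comodule $M$ is a right $\mathcal D$-comodule via $\tau_M(m)=m^{[0]}\epsilon_{\mathcal C}({m^{[1]}}_{[0]})\otimes_L{m^{[1]}}_{[1]}$, and $\mathcal C$-colinear maps are $\mathcal D$-colinear. Cleft bicomodules. An $L$-$\mathcal C$ bicomodule is a left $L$-module and right $\mathcal C$-comodule $\Sigma$ (an $L$-$A$ bimodule) with left $L$-linear $\mathcal C$-coaction. $T=\mathrm{End}^{\mathcal C}(\Sigma)$ is an algebra under composition and an $L$-ring via $l\mapsto(x\mapsto lx)$; $\Sigma^*=\mathrm{Hom}_A(\Sigma,A)$ is an $A$-$L$ bimodule via $(a\xi l)(x)=a\xi(lx)$. Put $$\widetilde Q=\{q\in{}_A\mathrm{Hom}_L(\mathcal C,\Sigma^* )\mid c^{(1)}q(c^{(2)})(x)=q(c)(x^{[0]})x^{[1]}\ \ \forall x\in\Sigma,\,c\in\mathcal C\}.$$ For $p\in{}_L\mathrm{Hom}^{\mathcal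 D}(\mathcal D,\Sigma)$ (left $L$-linear right $\mathcal D$-colinear maps) and $q\in\widetilde Q$ define $q\bullet p:\mathcal C\to\mathcal C$, $(q\bullet p)(c)=q(c_{[0]})\big(p(c_{[1]})^{[0]}\big)p(c_{[1]})^{[1]}$, and $p\lozenge q:\mathcal D\to T$, $(p\lozenge q)(d)=p(d)^{[0]}q(p(d)^{[1]})(-)$. $\Sigma$ is cleft for the extension if there exist $j\in{}_L\mathrm{Hom}^{\mathcal D}(\mathcal D,\Sigma)$ and $\tilde\jmath\in\widetilde Q$ with $\tilde\jmath\bullet j=\mathrm{id}_{\mathcal C}$ and $j\lozenge\tilde\jmath=\epsilon_{\mathcal D}(-)1_T$. ${}_L\mathrm{Hom}_L$ denotes $L$-bimodule maps. *)

(* Defs.v *)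
From HB Require Import structures.
From mathcomp Require Import all_boot all_algebra.
From mathcomp Require Import boolp classical_sets functions.

Set Implicit Arguments.
Unset Strict Implicit.
Unset Printing Implicit Defensive.

Import GRing.Theory.
Local Open Scope ring_scope.
Local Open Scope quotient_scope.

(* Tensor products over possibly noncommutative rings.  Since                 *)
(* - (m (x) n) = (- m) (x) n, the tensor product is already the quotient of   *)
(* the free commutative monoid on M * N (whose elements are the sequences of  *)
(* pairs up to permutation) by the biadditivity and balancing relations.      *)

Section GroupTensor.
Variables (R : Type) (M N : zmodType) (ra : M -> R -> M) (la : R -> N -> N).

Inductive tens_rel : seq (M * N) -> seq (M * N) -> Prop :=
| tens_refl s : tens_rel s s
| tens_sym s t : tens_rel s t -> tens_rel t s
| tens_trans s t u : tens_rel s t -> tens_rel t u -> tens_rel s u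
| tens_cat s s' t t' :
    tens_rel s s' -> tens_rel t t' -> tens_rel (s ++ t) (s' ++ t')
| tens_catC s t : tens_rel (s ++ t) (t ++ s)
| tens_0l n : tens_rel [:: (0, n)] [::]
| tens_Dl m m' n : tens_rel [:: (m + m', n)] [:: (m, n); (m', n)]
| tens_Dr m n n' : tens_rel [:: (m, n + n')] [:: (m, n); (m, n')]
| tens_bal m r n : tens_rel [:: (ra m r, n)] [:: (m, la r n)].

Definition tens_relb : rel (seq (M * N)) := fun s t => `[< tens_rel s t >].

Lemma tens_relb_refl : reflexive tens_relb.
Proof. by move=> s; apply/asboolP/tens_refl. Qed.
Lemma tens_relb_sym : symmetric tens_relb.
Proof. by move=> s t; apply/asboolP/asboolP; apply: tens_sym. Qed.
Lemma tens_relb_trans : transitive tens_relb.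
Proof.
by move=> t s u /asboolP st /asboolP tu; apply/asboolP; apply: tens_trans tu.
Qed.

Canonical tens_equiv :=
  EquivRel tens_relb tens_relb_refl tens_relb_sym tens_relb_trans.

Definition gtens : Type := {eq_quot tens_equiv}.
HB.instance Definition _ := Choice.on gtens.

Definition tclass (s : seq (M * N)) : gtens := \pi_({eq_quot tens_equiv}) s.
Definition trepr (x : gtens) : seq (M * N) := repr (x : {eq_quot tens_equiv}).

Lemma treprK x : tclass (trepr x) = x. Proof. exact: reprK. Qed.
Lemma tclassP s t : tclass s = tclass t <-> tens_rel s t.
Proof.
split=> [/eqmodP/asboolP //|st]; apply/eqmodP; exact/asboolP.
Qed.
Lemma trepr_class s : tens_rel (trepr (tclass s)) s.
Proof. by apply/tclassP; rewrite treprK. Qed.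

Definition topp_seq (s : seq (M * N)) := [seq (- p.1, p.2) | p <- s].
Definition tadd (x y : gtens) : gtens := tclass (trepr x ++ trepr y).
Definition topp (x : gtens) : gtens := tclass (topp_seq (trepr x)).

Lemma tens_N1 m n : tens_rel ([:: (- m, n)] ++ [:: (m, n)]) [::].
Proof.
apply: tens_trans (tens_0l n); apply: tens_sym.
by rewrite -(addNr m); apply: tens_Dl.
Qed.

Lemma tens_Nseq s : tens_rel (topp_seq s ++ s) [::].
Proof.
elim: s => [|[m n] s IH] /=; first exact: tens_refl.
apply: (tens_trans (t := ([:: (- m, n)] ++ [:: (m, n)]) ++ (topp_seq s ++ s))).
  rewrite -cat1s -(cat1s (m, n) s) -catA; apply: tens_cat; first exact: tens_refl.
  rewrite catA catA; apply: tens_cat; last exact: tens_refl.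
  exact: tens_catC.
rewrite -[X in tens_rel _ X](cats0 [::]).
exact: tens_cat (tens_N1 m n) IH.
Qed.

Lemma tadd_class s t : tadd (tclass s) (tclass t) = tclass (s ++ t).
Proof. by apply/tclassP; apply: tens_cat; apply: trepr_class. Qed.

Lemma taddA : associative tadd.
Proof.
move=> x y z; rewrite -(treprK x) -(treprK y) -(treprK z).
by rewrite !tadd_class catA.
Qed.
Lemma taddC : commutative tadd.
Proof. by move=> x y; apply/tclassP/tens_catC. Qed.
Lemma tadd0 : left_id (tclass [::]) tadd.
Proof. by move=> x; rewrite -[x in LHS]treprK tadd_class /= treprK. Qed.
Lemma taddN : left_inverse (tclass [::]) topp tadd.
Proof.
by move=> x; rewrite -[x in X in tadd _ X]treprK tadd_class; apply/tclassP/tens_Nseq.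
Qed.

HB.instance Definition _ :=
  GRing.isZmodule.Build gtens taddA taddC tadd0 taddN.

Definition gpure (m : M) (n : N) : gtens := tclass [:: (m, n)].

Lemma gpureDl m m' n : gpure (m + m') n = gpure m n + gpure m' n.
Proof. by rewrite [RHS]tadd_class; apply/tclassP/tens_Dl. Qed.
Lemma gpureDr m n n' : gpure m (n + n') = gpure m n + gpure m n'.
Proof. by rewrite [RHS]tadd_class; apply/tclassP/tens_Dr. Qed.
Lemma gpureA m r n : gpure (ra m r) n = gpure m (la r n).
Proof. exact/tclassP/tens_bal. Qed.

Definition balanced (G : zmodType) (f : M -> N -> G) : Prop :=
  [/\ forall m m' n, f (m + m') n = f m n + f m' n,
      forall m n n', f m (n + n') = f m n + f m n' &
      forall m r n, f (ra m r) n = f m (la r n)].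

(* [glift f] is the additive map m (x) n |-> f m n.  It is total, but it does *)
(* not depend on the chosen representative (and is additive) only when f is   *)
(* [balanced]; see glift_pure and gliftD.  A Sweedler expression              *)
(* "f x_(1) x_(2), where u = x_(1) (x) x_(2)" is rendered [glift f u], or     *)
(* [tlift f u] over tensor products of modules.                               *)
Definition glift (G : zmodType) (f : M -> N -> G) (x : gtens) : G :=
  \sum_(p <- trepr x) f p.1 p.2.

Lemma balanced0l (G : zmodType) (f : M -> N -> G) n : balanced f -> f 0 n = 0.
Proof.
by case=> fl _ _; apply: (addrI (f 0 n)); rewrite -fl !addr0.
Qed.

Lemma glift_class (G : zmodType) (f : M -> N -> G) s :
  balanced f -> glift f (tclass s) = \sum_(p <- s) f p.1 p.2.
Proof.
move=> fb; have [fl fr fa] := fb.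
suff sumE s0 t0 : tens_rel s0 t0 ->
    \sum_(p <- s0) f p.1 p.2 = \sum_(p <- t0) f p.1 p.2.
  exact/sumE/trepr_class.
elim=> {s0 t0} //.
- by move=> s0 t u _ -> _ ->.
- by move=> s0 s' t t' _ e _ e'; rewrite !big_cat /= e e'.
- by move=> s0 t; rewrite !big_cat /= addrC.
- by move=> n; rewrite big_seq1 big_nil; exact: balanced0l.
- by move=> m m' n; rewrite big_seq1 big_cons big_seq1; apply: fl.
- by move=> m n n'; rewrite big_seq1 big_cons big_seq1; apply: fr.
- by move=> m r n; rewrite !big_seq1; apply: fa.
Qed.

Lemma glift_pure (G : zmodType) (f : M -> N -> G) m n :
  balanced f -> glift f (gpure m n) = f m n.
Proof. by move=> fb; rewrite glift_class // big_seq1. Qed.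

Lemma gliftD (G : zmodType) (f : M -> N -> G) x y :
  balanced f -> glift f (x + y) = glift f x + glift f y.
Proof.
move=> fb; rewrite -(treprK x) -(treprK y) [X in glift f X]tadd_class.
by rewrite !glift_class // big_cat.
Qed.

Lemma eq_glift (G : zmodType) (f g : M -> N -> G) x :
  (forall m n, f m n = g m n) -> glift f x = glift g x.
Proof. by move=> fg; apply: eq_bigr => p _. Qed.
Lemma glift0f (G : zmodType) x : glift (fun _ _ => 0 : G) x = 0.
Proof. exact: big1. Qed.
Lemma gliftDf (G : zmodType) (f g : M -> N -> G) x :
  glift (fun m n => f m n + g m n) x = glift f x + glift g x.
Proof. exact: big_split. Qed.
Lemma gliftBf (G : zmodType) (f g : M -> N -> G) x :
  glift (fun m n => f m n - g m n) x = glift f x - glift g x.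
Proof. exact: sumrB. Qed.

Lemma gtens_ind (P : gtens -> Prop) :
  P 0 -> (forall m n x, P x -> P (gpure m n + x)) -> forall x, P x.
Proof.
move=> P0 PD x; rewrite -(treprK x); elim: (trepr x) => [|[m n] s IH] //.
by have := PD m n _ IH; rewrite [_ + _]tadd_class.
Qed.

End GroupTensor.


Arguments gpure {R M N} ra la.
Arguments glift {R M N} ra la {G}.
(* Keeps unification from unfolding tensor products. *)
#[global] Opaque gtens tclass trepr tadd topp gpure glift.

(* k-algebras.  MathComp's algType excludes the zero ring, which can occur    *)
(* here (e.g. as an endomorphism algebra).                                    *)
Record kalg (k : comPzRingType) := Kalg {
  kring :> pzRingType;
  kmap : {rmorphism k -> kring};
  kmapC : forall (c : k) (a : kring), kmap c * a = a * kmap c }.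

(* Right R-modules are left modules over the converse ring. *)
Notation rmodType R := (lmodType R^c).

Definition rscale (R : pzRingType) (M : rmodType R) (m : M) (r : R) : M :=
  (r : R^c) *: m.
Notation "m <* r" := (rscale m r) (at level 40, left associativity) : ring_scope.

Section RightModule.
Variables (R : pzRingType) (M : rmodType R).
Implicit Types (m : M) (r : R).
Lemma rscaleDl m m' r : (m + m') <* r = m <* r + m' <* r.
Proof. exact: scalerDr. Qed.
Lemma rscaleDr m r r' : m <* (r + r') = m <* r + m <* r'.
Proof. exact: scalerDl. Qed.
Lemma rscaleA m r r' : m <* (r * r') = m <* r <* r'.
Proof. by rewrite /rscale scalerA. Qed.
Lemma rscale1 m : m <* 1 = m.
Proof. exact: scale1r. Qed.
Lemma rscale0l r : (0 : M) <* r = 0.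
Proof. exact: scaler0. Qed.
End RightModule.

Lemma linear_rscale (R : pzRingType) (M N : rmodType R) (f : {linear M -> N})
  (m : M) (r : R) : f (m <* r) = f m <* r.
Proof. exact: linearZ. Qed.

Definition rlin (R : pzRingType) (M N : rmodType R) (f : M -> N) : Prop :=
  (forall x y, f (x + y) = f x + f y) /\ forall m (r : R), f (m <* r) = f m <* r.

Section MkLinear.
Variables (R : pzRingType) (M N : rmodType R) (f : M -> N) (fP : rlin f).
Lemma mklinear_subproof : linear f.
Proof. by case: fP => fD fZ a x y; rewrite fD; congr (_ + _); apply: fZ. Qed.
Definition mklinear : {linear M -> N} :=
  HB.pack f (GRing.isLinear.Build R^c M N *:%R f mklinear_subproof).
End MkLinear.

Lemma linear_ext (R : pzRingType) (M N : rmodType R) (f g : {linear M -> N}) :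
  f =1 g -> f = g.
Proof.
case: f g => [f [[cf] [sf]]] [g [[cg] [sg]]] /= fg.
have {}fg : f = g by apply/funext.
rewrite {}fg in cf sf *.
by congr GRing.Linear.Pack; congr GRing.Linear.Class;
  [congr Algebra.isNmodMorphism.Axioms_| congr GRing.isScalable.Axioms_];
  apply: Prop_irrelevance.
Qed.

Record raction (V : zmodType) (R : pzRingType) := Raction {
  ract :> V -> R -> V;
  ractDl : forall x y r, ract (x + y) r = ract x r + ract y r;
  ractDr : forall x r r', ract x (r + r') = ract x r + ract x r';
  ractA : forall x r r', ract x (r * r') = ract (ract x r) r';
  ract1 : forall x, ract x 1 = x }.

(* [racted a] is V with the right module structure given by a. *)
Section Racted.
Variables (V : zmodType) (R : pzRingType) (a : raction V R).
Definition racted_sort : Type := V.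
HB.instance Definition _ := GRing.Zmodule.on racted_sort.
Lemma racted_A (r r' : R^c) (x : racted_sort) :
  a (a x r') r = a x (r * r').
Proof. by rewrite -ractA. Qed.
HB.instance Definition _ := GRing.Zmodule_isLmodule.Build R^c racted_sort
  racted_A (@ract1 _ _ a) (fun r x y => @ractDl _ _ a x y r)
  (fun x r r' => @ractDr _ _ a x r r').
Definition racted : rmodType R := racted_sort.
End Racted.

(* An A-B bimodule: a left A-module with a compatible right B-action, such    *)
(* that the two induced actions of k agree.                                   *)
Record bimod (k : comPzRingType) (A B : kalg k) := Bimod {
  bleft :> lmodType A;
  bract : raction bleft B;
  bractZ : forall (a : A) x (b : B), bract (a *: x) b = a *: bract x b;
  bimod_k : forall (z : k) x, kmap A z *: x = bract x (kmap B z) }.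

Definition bright (k : comPzRingType) (A B : kalg k) (N : bimod A B) :
  rmodType B := racted (bract N).

Section Tensor.
Variables (R : pzRingType) (M : rmodType R) (N : lmodType R).

(* M (x)_R N *)
Definition tensor : zmodType :=
  gtens (@rscale R M) (fun (r : R) (n : N) => r *: n).

Definition tpure (m : M) (n : N) : tensor :=
  gpure (@rscale R M) (fun (r : R) (n : N) => r *: n) m n.
Definition tlift (G : zmodType) (f : M -> N -> G) (x : tensor) : G :=
  glift (@rscale R M) (fun (r : R) (n : N) => r *: n) f x.
Definition tbalanced (G : zmodType) (f : M -> N -> G) : Prop :=
  balanced (@rscale R M) (fun (r : R) (n : N) => r *: n) f.
End Tensor.

Arguments tensor {R} M N.
Arguments tpure {R M N} m n.
Arguments tlift {R M N G} f x.
Arguments tbalanced {R} M N {G} f.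
Notation "m ⊗ n" := (tpure m n) (at level 40, left associativity) : ring_scope.

Section TensorTheory.
Variables (R : pzRingType) (M : rmodType R) (N : lmodType R).

Lemma tpureDl (m m' : M) (n : N) : (m + m') ⊗ n = m ⊗ n + m' ⊗ n.
Proof. exact: gpureDl. Qed.
Lemma tpureDr (m : M) (n n' : N) : m ⊗ (n + n') = m ⊗ n + m ⊗ n'.
Proof. exact: gpureDr. Qed.
Lemma tpureA (m : M) (r : R) (n : N) : (m <* r) ⊗ n = m ⊗ (r *: n).
Proof. exact: gpureA. Qed.

Lemma tlift_pure (G : zmodType) (f : M -> N -> G) m n :
  tbalanced M N f -> tlift f (m ⊗ n) = f m n.
Proof. exact: glift_pure. Qed.
Lemma tliftD (G : zmodType) (f : M -> N -> G) :
  tbalanced M N f -> forall x y, tlift f (x + y) = tlift f x + tlift f y.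
Proof. by move=> fb x y; apply: gliftD. Qed.
Lemma eq_tlift (G : zmodType) (f g : M -> N -> G) x :
  (forall m n, f m n = g m n) -> tlift f x = tlift g x.
Proof. exact: eq_glift. Qed.
Lemma tlift0f (G : zmodType) (x : tensor M N) : tlift (fun _ _ => 0 : G) x = 0.
Proof. exact: glift0f. Qed.
Lemma tliftDf (G : zmodType) (f g : M -> N -> G) (x : tensor M N) :
  tlift (fun m n => f m n + g m n) x = tlift f x + tlift g x.
Proof. exact: gliftDf. Qed.
Lemma tliftBf (G : zmodType) (f g : M -> N -> G) (x : tensor M N) :
  tlift (fun m n => f m n - g m n) x = tlift f x - tlift g x.
Proof. exact: gliftBf. Qed.
Lemma tensor_ind (P : tensor M N -> Prop) :
  P 0 -> (forall m n x, P x -> P (m ⊗ n + x)) -> forall x, P x.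
Proof. exact: gtens_ind. Qed.
Lemma tensor_ext (G : zmodType) (f g : tensor M N -> G) :
    (forall x y, f (x + y) = f x + f y) -> (forall x y, g (x + y) = g x + g y) ->
  (forall m n, f (m ⊗ n) = g (m ⊗ n)) -> f =1 g.
Proof.
move=> fD gD fg.
have z (h : tensor M N -> G) : (forall x y, h (x + y) = h x + h y) -> h 0 = 0.
  by move=> hD; apply: (addrI (h 0)); rewrite -hD !addr0.
elim/tensor_ind => [|m n x IH]; first by rewrite !z.
by rewrite fD gD fg IH.
Qed.
End TensorTheory.
#[global] Opaque tpure tlift.

Section RightTensor.
Variables (k : comPzRingType) (R S : kalg k) (M : rmodType R) (N : bimod R S).

Definition tens_ract (x : tensor M N) (s : S) : tensor M N :=
  tlift (fun m n => m ⊗ bract N n s) x.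

Lemma tens_ract_balanced (s : S) :
  tbalanced M N (fun m n => m ⊗ bract N n s : tensor M N).
Proof.
split=> [m m' n|m n n'|m r n]; first by rewrite tpureDl.
  by rewrite ractDl tpureDr.
by rewrite bractZ tpureA.
Qed.

Lemma tens_ractDl x y s : tens_ract (x + y) s = tens_ract x s + tens_ract y s.
Proof. exact: (tliftD (tens_ract_balanced s) x y). Qed.
Lemma tens_ractE m n s : tens_ract (m ⊗ n) s = m ⊗ bract N n s.
Proof. exact: (tlift_pure _ _ (tens_ract_balanced s)). Qed.
Lemma tens_ractDr x s s' : tens_ract x (s + s') = tens_ract x s + tens_ract x s'.
Proof.
move: x; apply: tensor_ext => [x y|x y|m n].
- exact: tens_ractDl.
- by rewrite !tens_ractDl addrACA.
- by rewrite !tens_ractE ractDr tpureDr.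
Qed.
Lemma tens_ractA x s s' : tens_ract x (s * s') = tens_ract (tens_ract x s) s'.
Proof.
move: x; apply: tensor_ext => [x y|x y|m n].
- exact: tens_ractDl.
- by rewrite !tens_ractDl.
- by rewrite !tens_ractE ractA.
Qed.
Lemma tens_ract1 x : tens_ract x 1 = x.
Proof.
move: x; apply: (@tensor_ext _ _ _ _ (tens_ract^~ 1) id) => [x y|//|m n].
- exact: tens_ractDl.
- by rewrite !tens_ractE ract1.
Qed.

Definition tens_raction : raction (tensor M N) S :=
  Raction tens_ractDl tens_ractDr tens_ractA tens_ract1.

(* M (x)_R N as a right S-module *)
Definition tens : rmodType S := racted tens_raction.

Lemma tpure_rscale (m : M) (n : N) (s : S) :
  (m ⊗ n : tens) <* s = m ⊗ bract N n s.
Proof. exact: tens_ractE. Qed.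
End RightTensor.
Arguments tens {k R S} M N.

Section BimoduleTensor.
Variables (k : comPzRingType) (A R : kalg k) (M : bimod A R).

Section LeftTensor.
Variable N : lmodType R.

Definition tens_lact (a : A) (x : tensor (bright M) N) : tensor (bright M) N :=
  tlift (fun (m : bright M) n => (a *: (m : M) : bright M) ⊗ n) x.

Lemma tens_lact_balanced a : tbalanced (bright M) N
  (fun (m : bright M) n => (a *: (m : M) : bright M) ⊗ n).
Proof.
split=> [m m' n|m n n'|m r n]; first by rewrite [a *: _]scalerDr [LHS]tpureDl.
  by rewrite tpureDr.
by rewrite -[a *: _](@bractZ _ _ _ M a m r) -tpureA.
Qed.

Lemma tens_lactDr a x y : tens_lact a (x + y) = tens_lact a x + tens_lact a y.
Proof. exact: (tliftD (tens_lact_balanced a) x y). Qed.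
Lemma tens_lactE a m n : tens_lact a (m ⊗ n) = (a *: (m : M) : bright M) ⊗ n.
Proof. exact: tlift_pure (tens_lact_balanced a). Qed.
Lemma tens_lactDl x a a' : tens_lact (a + a') x = tens_lact a x + tens_lact a' x.
Proof.
move: x; apply: tensor_ext => [x y|x y|m n].
- exact: tens_lactDr.
- by rewrite !tens_lactDr addrACA.
- by rewrite !tens_lactE [(a + a') *: _]scalerDl [LHS]tpureDl.
Qed.
Lemma tens_lactA a a' x : tens_lact a (tens_lact a' x) = tens_lact (a * a') x.
Proof.
move: x; apply: tensor_ext => [x y|x y|m n].
- by rewrite !tens_lactDr.
- by rewrite !tens_lactDr.
- by rewrite !tens_lactE [a *: (_ *: _)]scalerA.
Qed.
Lemma tens_lact1 x : tens_lact 1 x = x.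
Proof.
move: x; apply: (@tensor_ext _ _ _ _ (tens_lact 1) id) => [x y|//|m n].
  exact: tens_lactDr.
by rewrite !tens_lactE [1 *: _]scale1r.
Qed.

(* M (x)_R N as a left A-module *)
Definition ltens : lmodType A :=
  HB.pack (GRing.Zmodule.sort (tensor (bright M) N))
    (GRing.Zmodule_isLmodule.Build A (tensor (bright M) N)
       tens_lactA tens_lact1 tens_lactDr tens_lactDl).

Lemma tpure_scale (a : A) (m : bright M) (n : N) :
  a *: (m ⊗ n : ltens) = (a *: (m : M) : bright M) ⊗ n.
Proof. exact: tens_lactE. Qed.
End LeftTensor.

Section BiTensor.
Variables (S : kalg k) (N : bimod R S).

Lemma ltens_bractZ (a : A) (x : ltens N) (s : S) :
  tens_ract (a *: x) s = a *: (tens_ract x s : ltens N).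
Proof.
move: x; apply: tensor_ext => [x y|x y|m n].
- by rewrite [_ *: _]tens_lactDr tens_ractDl.
- by rewrite tens_ractDl [LHS]tens_lactDr.
- by rewrite tens_ractE !tpure_scale tens_ractE.
Qed.
Lemma ltens_bimod_k (z : k) (x : ltens N) :
  kmap A z *: x = tens_ract x (kmap S z).
Proof.
move: x; apply: tensor_ext => [x y|x y|m n].
- exact: tens_lactDr.
- exact: tens_ractDl.
- by rewrite tpure_scale tens_ractE [_ *: _](@bimod_k _ _ _ M z m) -(@bimod_k _ _ _ N z n) -tpureA.
Qed.

Definition btens : bimod A S :=
  @Bimod k A S (ltens N) (tens_raction (bright M) N) ltens_bractZ ltens_bimod_k.
End BiTensor.
End BimoduleTensor.
Arguments ltens {k A R} M N.
Arguments btens {k A R} M {S} N.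

Section TensorMap.
Variables (R : pzRingType) (M M' : rmodType R) (N N' : lmodType R).

(* f (x) g, meaningful when f is right R-linear and g is left R-linear *)
Definition tmap (f : M -> M') (g : N -> N') : tensor M N -> tensor M' N' :=
  tlift (fun m n => f m ⊗ g n).

Lemma tmap_balanced (f : M -> M') (g : N -> N') :
    (forall x y, f (x + y) = f x + f y) ->
    (forall m (r : R), f (m <* r) = f m <* r) ->
    (forall x y, g (x + y) = g x + g y) ->
    (forall (r : R) n, g (r *: n) = r *: g n) ->
  tbalanced M N (fun m n => f m ⊗ g n : tensor M' N').
Proof.
move=> fD fZ gD gZ; split=> [m m' n|m n n'|m r n].
- by rewrite fD tpureDl.
- by rewrite gD tpureDr.
- by rewrite fZ gZ tpureA.
Qed.
End TensorMap.

Section Associator.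
Variables (k : comPzRingType) (R S : kalg k).
Variables (M : rmodType R) (N : bimod R S) (P : lmodType S).

Definition tassoc : tensor (tens M N) P -> tensor M (ltens N P) :=
  tlift (fun (x : tens M N) p =>
    tlift (fun (m : M) (n : N) => m ⊗ ((n : bright N) ⊗ p : ltens N P))
      (x : tensor M N)).
Definition tassocV : tensor M (ltens N P) -> tensor (tens M N) P :=
  tlift (fun (m : M) (y : ltens N P) =>
    tlift (fun (n : bright N) p => (m ⊗ (n : N) : tens M N) ⊗ p)
      (y : tensor (bright N) P)).

Lemma tassoc_balanced1 p :
  tbalanced M N (fun (m : M) (n : N) => m ⊗ ((n : bright N) ⊗ p : ltens N P)).
Proof.
split=> [m m' n|m n n'|m r n]; first by rewrite tpureDl.
  by rewrite -[RHS]tpureDr -[_ + _ in RHS]tpureDl.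
by rewrite tpureA tpure_scale.
Qed.
Lemma tassoc_balanced : tbalanced (tens M N) P
  (fun x p =>
    tlift (fun (m : M) (n : N) => m ⊗ ((n : bright N) ⊗ p : ltens N P))
      (x : tensor M N)).
Proof.
split=> [x x' p|x p p'|x s p].
- exact: (tliftD (tassoc_balanced1 p)).
- move: x; apply: (@tensor_ext _ M N) => [x y|x y|m n].
  + exact: (tliftD (tassoc_balanced1 _)).
  + by rewrite !(tliftD (tassoc_balanced1 _)) addrACA.
  + rewrite !(tlift_pure _ _ (tassoc_balanced1 _)) [_ ⊗ (p + p')]tpureDr.
    exact: tpureDr.
- move: x; apply: (@tensor_ext _ M N) => [x y|x y|m n].
  + by rewrite [X in tlift _ X]tens_ractDl (tliftD (tassoc_balanced1 _)).
  + exact: (tliftD (tassoc_balanced1 _)).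
  + rewrite [X in tlift _ X]tens_ractE !(tlift_pure _ _ (tassoc_balanced1 _)).
    by rewrite -tpureA.
Qed.
Lemma tassocD x y : tassoc (x + y) = tassoc x + tassoc y.
Proof. exact: (tliftD tassoc_balanced x y). Qed.
Lemma tassocE (m : M) (n : N) (p : P) :
  tassoc ((m ⊗ n : tens M N) ⊗ p) = m ⊗ ((n : bright N) ⊗ p : ltens N P).
Proof.
rewrite /tassoc (tlift_pure _ _ tassoc_balanced).
exact: tlift_pure (tassoc_balanced1 p).
Qed.

Lemma tassocV_balanced1 m :
  tbalanced (bright N) P (fun n p => (m ⊗ (n : N) : tens M N) ⊗ p).
Proof.
split=> [n n' p|n p p'|n s p].
- by rewrite -[RHS]tpureDl -[_ + _ in RHS]tpureDr.
- by rewrite tpureDr.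
- by rewrite -[RHS]tpureA tpure_rscale.
Qed.
Lemma tassocV_balanced : tbalanced M (ltens N P) (fun m (y : ltens N P) =>
    tlift (fun (n : bright N) p => (m ⊗ (n : N) : tens M N) ⊗ p)
      (y : tensor (bright N) P)).
Proof.
split=> [m m' y|m y y'|m r y].
- move: y; apply: (@tensor_ext _ (bright N) P) => [x y|x y|n p].
  + exact: (tliftD (tassocV_balanced1 _)).
  + by rewrite !(tliftD (tassocV_balanced1 _)) addrACA.
  + rewrite !(tlift_pure _ _ (tassocV_balanced1 _)) [(m + m') ⊗ _]tpureDl.
    exact: tpureDl.
- exact: (tliftD (tassocV_balanced1 _)).
- move: y; apply: (@tensor_ext _ (bright N) P) => [x y|x y|n p].
  + exact: (tliftD (tassocV_balanced1 _)).
  + rewrite [r *: _]tens_lactDr.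
    exact: (tliftD (tassocV_balanced1 _)).
  + rewrite [r *: _]tens_lactE !(tlift_pure _ _ (tassocV_balanced1 _)).
    by rewrite tpureA.
Qed.
Lemma tassocVD x y : tassocV (x + y) = tassocV x + tassocV y.
Proof. exact: (tliftD tassocV_balanced x y). Qed.
Lemma tassocVE (m : M) (n : N) (p : P) :
  tassocV (m ⊗ ((n : bright N) ⊗ p : ltens N P)) = (m ⊗ n : tens M N) ⊗ p.
Proof.
rewrite /tassocV (tlift_pure _ _ tassocV_balanced).
exact: tlift_pure (tassocV_balanced1 m).
Qed.
Lemma tassocK : cancel tassoc tassocV.
Proof.
apply: (@tensor_ext _ _ _ _ (tassocV \o tassoc) id) => [x y|//|x p] /=.
  by rewrite tassocD tassocVD.
move: x; apply: (@tensor_ext _ M N _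
    (fun x => tassocV (tassoc ((x : tens M N) ⊗ p)))
    (fun x => (x : tens M N) ⊗ p)) => [x y|x y|m n].
- by rewrite [_ ⊗ p]tpureDl tassocD tassocVD.
- exact: tpureDl.
- by rewrite tassocE tassocVE.
Qed.
Lemma tassocVK : cancel tassocV tassoc.
Proof.
apply: (@tensor_ext _ _ _ _ (tassoc \o tassocV) id) => [x y|//|m y] /=.
  by rewrite tassocVD tassocD.
move: y; apply: (@tensor_ext _ (bright N) P _
    (fun y => tassoc (tassocV (m ⊗ (y : ltens N P))))
    (fun y => m ⊗ (y : ltens N P))) => [x y|x y|n p].
- by rewrite [m ⊗ _]tpureDr tassocVD tassocD.
- exact: tpureDr.
- by rewrite tassocVE tassocE.
Qed.
End Associator.

Definition llin (R : pzRingType) (M N : lmodType R) (g : M -> N) : Prop :=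
  (forall x y, g (x + y) = g x + g y) /\ forall (r : R) m, g (r *: m) = r *: g m.

Lemma linear_rlin (R : pzRingType) (M N : rmodType R) (f : {linear M -> N}) :
  rlin f.
Proof. by split=> [x y|m r]; [exact: linearD | exact: linear_rscale]. Qed.
Lemma id_rlin (R : pzRingType) (M : rmodType R) : rlin (id : M -> M).
Proof. by []. Qed.
Lemma id_llin (R : pzRingType) (M : lmodType R) : llin (id : M -> M).
Proof. by []. Qed.
#[global] Hint Resolve linear_rlin id_rlin id_llin : core.

Section TensorMapTheory.
Variables (R : pzRingType) (M M' : rmodType R) (N N' : lmodType R).
Variables (f : M -> M') (g : N -> N').
Hypotheses (fP : rlin f) (gP : llin g).

Lemma tmapE m n : tmap f g (m ⊗ n) = f m ⊗ g n.
Proof. by case: fP gP => ? ? [? ?]; rewrite [LHS]tlift_pure //; exact: tmap_balanced. Qed.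
Lemma tmapD x y : tmap f g (x + y) = tmap f g x + tmap f g y.
Proof. by case: fP gP => ? ? [? ?]; apply: tliftD; exact: tmap_balanced. Qed.
End TensorMapTheory.

Section TensorMapLinear.
Variables (k : comPzRingType) (R S : kalg k).
Variables (M M' : rmodType R) (N N' : bimod R S).
Variables (f : M -> M') (g : N -> N').
Hypotheses (fP : rlin f) (gP : llin g).
Hypothesis gr : forall n (s : S), g (bract N n s) = bract N' (g n) s.

Lemma tmap_rscale (x : tens M N) (s : S) :
  tmap f g (x <* s) = (tmap f g x : tens M' N') <* s.
Proof.
move: x; apply: (@tensor_ext _ M N) => [x y|x y|m n].
- by rewrite [X in tmap _ _ X]tens_ractDl tmapD.
- by rewrite tmapD // [LHS]tens_ractDl.
- by rewrite [X in tmap _ _ X]tens_ractE !tmapE // gr [RHS]tens_ractE.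
Qed.
Lemma tmap_rlin : rlin (tmap f g : tens M N -> tens M' N').
Proof. by split=> [|m r]; [exact: tmapD | exact: tmap_rscale]. Qed.
End TensorMapLinear.

Section AssociatorLinear.
Variables (k : comPzRingType) (R S U : kalg k).
Variables (M : rmodType R) (N : bimod R S) (P : bimod S U).
Lemma tassoc_rscale (x : tens (tens M N) P) (u : U) :
  tassoc (x <* u) = (tassoc x : tens M (btens N P)) <* u.
Proof.
move: x; apply: (@tensor_ext _ (tens M N) P) => [x y|x y|x p].
- by rewrite [X in tassoc X]tens_ractDl tassocD.
- by rewrite tassocD [LHS](@tens_ractDl _ _ _ M (btens N P)).
rewrite [X in tassoc X]tens_ractE.
move: x; apply: (@tensor_ext _ M N _
  (fun x => tassoc ((x : tens M N) ⊗ bract P p u))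
  (fun x => (tassoc ((x : tens M N) ⊗ p) : tens M (btens N P)) <* u))
  => [x y|x y|m n].
- by rewrite [_ ⊗ bract P p u]tpureDl tassocD.
- by rewrite [_ ⊗ p]tpureDl tassocD [LHS](@tens_ractDl _ _ _ M (btens N P)).
- rewrite !tassocE [RHS](@tens_ractE _ _ _ M (btens N P)).
  by congr (_ ⊗ _); rewrite [RHS]tens_ractE.
Qed.
Lemma tassocV_rscale (x : tens M (btens N P)) (u : U) :
  tassocV (x <* u) = (tassocV x : tens (tens M N) P) <* u.
Proof.
apply: (can_inj (@tassocK _ _ _ _ _ _)).
by rewrite tassocVK tassoc_rscale tassocVK.
Qed.
Lemma tassoc_rlin :
  rlin (@tassoc _ _ _ M N P : tens (tens M N) P -> tens M (btens N P)).
Proof. by split; [exact: tassocD | exact: tassoc_rscale]. Qed.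
Lemma tassocV_rlin :
  rlin (@tassocV _ _ _ M N P : tens M (btens N P) -> tens (tens M N) P).
Proof. by split; [exact: tassocVD | exact: tassocV_rscale]. Qed.
End AssociatorLinear.

Record coring (k : comPzRingType) (A : kalg k) := Coring {
  cor_bimod :> bimod A A;
  comul : {linear bright cor_bimod -> tens (bright cor_bimod) cor_bimod};
  counit : cor_bimod -> A;
  comulZ : forall (a : A) (c : cor_bimod),
    comul (a *: c) = a *: (comul c : ltens cor_bimod cor_bimod);
  counitD : forall c d, counit (c + d) = counit c + counit d;
  counitZ : forall (a : A) c, counit (a *: c) = a * counit c;
  counit_bract : forall c (a : A), counit (bract cor_bimod c a) = counit c * a;
  comul_coassoc : forall c : cor_bimod,
    tassoc (tmap comul id (comul c))
    = tmap id (comul : cor_bimod -> ltens cor_bimod cor_bimod) (comul c);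
  comul_counitl : forall c : cor_bimod,
    tlift (fun (c1 : bright cor_bimod) (c2 : cor_bimod) => counit c1 *: c2)
      (comul c) = c;
  comul_counitr : forall c : cor_bimod,
    tlift (fun (c1 : bright cor_bimod) (c2 : cor_bimod) => c1 <* counit c2)
      (comul c) = c }.

(* Right C-coactions on the right A-module M. *)
Record coaction (k : comPzRingType) (A : kalg k) (C : coring A)
    (M : rmodType A) := Coaction {
  coact :> {linear M -> tens M C};
  coact_coassoc : forall m,
    tassoc (tmap coact id (coact m))
    = tmap id (@comul _ _ C : C -> ltens C C) (coact m);
  coact_counit : forall m,
    tlift (fun (m0 : M) (m1 : C) => m0 <* counit m1) (coact m) = m }.

Record comod (k : comPzRingType) (A : kalg k) (C : coring A) := Comod {
  comod_mod :> rmodType A;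
  comod_coact : coaction C comod_mod }.
Notation rho := (comod_coact _).

Section ColinearMaps.
Variables (k : comPzRingType) (A : kalg k) (C : coring A) (M N : comod C).

Definition colinear (f : M -> N) : Prop :=
  linear f /\ forall m, rho (f m) = tmap f id (rho m).
Definition colinearb : {pred M -> N} := [pred f | `[< colinear f >]].

Lemma colinear_rlin f : colinear f -> rlin f.
Proof.
case=> fl _; exact: (linear_rlin (HB.pack f (GRing.isLinear.Build _ _ _ _ f fl))).
Qed.

Lemma colinear_zmod_closed : zmod_closed colinearb.
Proof.
split=> [|f g /asboolP[fl fr] /asboolP[gl gr]]; apply/asboolP; split.
- by move=> a x y; rewrite scaler0 addr0.
- move=> m; rewrite linear0 -[LHS](tlift0f _ (rho m)); apply: eq_tlift => m' c.
  by apply: (addrI (0 ⊗ c)); rewrite -tpureDl !addr0.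
- move=> a x y; rewrite /= !fctE fl gl scalerBr.
  by rewrite opprD addrACA.
- move=> m; rewrite !fctE linearB /= fr gr -tliftBf.
  by apply: eq_tlift => m' c; apply/eqP; rewrite subr_eq -tpureDl subrK.
Qed.
HB.instance Definition _ :=
  GRing.isZmodClosed.Build (M -> N) colinearb colinear_zmod_closed.

Record chom := Chom { chom_fun :> M -> N; chomP : chom_fun \in colinearb }.
HB.instance Definition _ := [isSub for chom_fun].
HB.instance Definition _ := [Choice of chom by <:].
HB.instance Definition _ := [SubChoice_isSubZmodule of chom by <:].

Definition mkchom (f : M -> N) (fP : colinear f) : chom :=
  Chom (introT (asboolP (colinear f)) fP).
Lemma chom_colinear (f : chom) : colinear f.
Proof. by have /asboolP := chomP f. Qed.
Lemma chom_rlin (f : chom) : rlin f.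
Proof. exact/colinear_rlin/chom_colinear. Qed.
Lemma chom_coact (f : chom) m : rho (f m) = tmap f id (rho m).
Proof. by have [_] := chom_colinear f. Qed.
Lemma chom_ext (f g : chom) : f =1 g -> f = g.
Proof. by move=> fg; apply/val_inj/funext. Qed.
Lemma colinearP (f : M -> N) :
  rlin f -> (forall m, rho (f m) = tmap f id (rho m)) -> colinear f.
Proof. by case=> fD fZ fr; split=> // a x y; rewrite fD; congr (_ + _); exact: fZ. Qed.
End ColinearMaps.
#[global] Hint Resolve chom_rlin : core.

Section ColinearComposition.
Variables (k : comPzRingType) (A : kalg k) (C : coring A).

Lemma id_colinear (M : comod C) : colinear (id : M -> M).
Proof.
apply: colinearP => // m; move: (rho m).
apply: (@tensor_ext _ _ _ _ id) => [//||x c]; first exact: tmapD.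
by rewrite tmapE.
Qed.
Definition chom_id (M : comod C) : chom M M := mkchom (id_colinear M).

Lemma comp_rlin (R : pzRingType) (M N P : rmodType R) (g : N -> P) (f : M -> N) :
  rlin g -> rlin f -> rlin (g \o f).
Proof. by move=> [gD gZ] [fD fZ]; split=> [x y|x r] /=; rewrite ?fD ?gD ?fZ ?gZ. Qed.

Lemma comp_colinear (M N P : comod C) (g : chom N P) (f : chom M N) :
  colinear (g \o f).
Proof.
apply: colinearP => [|m]; first exact: comp_rlin.
rewrite /= !chom_coact; move: (rho m).
apply: (@tensor_ext _ _ _ _ (tmap g id \o tmap f id)) => [x y|x y|x c] /=.
- by rewrite !tmapD.
- by rewrite tmapD //; exact: comp_rlin.
- by rewrite !tmapE //; exact: comp_rlin.
Qed.
Definition chom_comp (M N P : comod C) (g : chom N P) (f : chom M N) : chom M P :=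
  mkchom (comp_colinear g f).
End ColinearComposition.

Record category := Category {
  obj :> Type;
  hom : obj -> obj -> Type;
  idm : forall X, hom X X;
  hcomp : forall X Y Z, hom Y Z -> hom X Y -> hom X Z;
  hcomp_idl : forall X Y (f : hom X Y), hcomp (idm Y) f = f;
  hcomp_idr : forall X Y (f : hom X Y), hcomp f (idm X) = f;
  hcompA : forall X Y Z W (h : hom Z W) (g : hom Y Z) (f : hom X Y),
    hcomp h (hcomp g f) = hcomp (hcomp h g) f }.
Arguments idm {_} X.

Record functor (C D : category) := Functor {
  fobj :> C -> D;
  fmap : forall X Y, hom X Y -> hom (fobj X) (fobj Y);
  fmap_id : forall X, fmap (idm X) = idm (fobj X);
  fmap_comp : forall X Y Z (g : hom Y Z) (f : hom X Y),
    fmap (hcomp g f) = hcomp (fmap g) (fmap f) }.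
Arguments fmap {C D} _ [X Y] _.

Section CategoryTheory.
Implicit Types C D E : category.

Definition functor_id C : functor C C :=
  @Functor C C id (fun X Y f => f) (fun X => erefl) (fun X Y Z g f => erefl).

Definition functor_comp C D E (G : functor D E) (F : functor C D) : functor C E.
Proof.
refine (@Functor C E (fun X => G (F X)) (fun X Y f => fmap G (fmap F f)) _ _).
- by move=> X; rewrite !fmap_id.
- by move=> X Y Z g f; rewrite !fmap_comp.
Defined.

Definition is_iso C (X Y : C) (f : hom X Y) : Prop :=
  exists g : hom Y X, hcomp g f = idm X /\ hcomp f g = idm Y.

Definition naturally_isomorphic C D (F G : functor C D) : Prop :=
  exists eta : forall X, hom (F X) (G X),
    (forall X Y (f : hom X Y), hcomp (eta Y) (fmap F f) = hcomp (fmap G f) (eta X))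
    /\ forall X, is_iso (eta X).

Definition fully_faithful C D (F : functor C D) : Prop :=
  forall (X Y : C) (g : hom (F X) (F Y)), exists! f : hom X Y, fmap F f = g.

Definition inverse_equivalences C D (F : functor C D) (G : functor D C) : Prop :=
  naturally_isomorphic (functor_comp G F) (functor_id C)
  /\ naturally_isomorphic (functor_comp F G) (functor_id D).

Definition is_equalizer C (X Y Z : C) (e : hom X Y) (f g : hom Y Z) : Prop :=
  hcomp f e = hcomp g e /\
  forall (W : C) (h : hom W Y), hcomp f h = hcomp g h ->
    exists! u : hom W X, hcomp e u = h.
End CategoryTheory.

Section ModuleCategories.
Variable R : pzRingType.

Definition lin_comp (M N P : rmodType R) (g : {linear N -> P})
  (f : {linear M -> N}) : {linear M -> P} := g \o f.

Definition modcat : category.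
Proof.
refine (@Category (rmodType R) (fun M N => {linear M -> N})
  (fun M => (idfun : {linear M -> M})) lin_comp _ _ _);
  by move=> *; apply: linear_ext.
Defined.
End ModuleCategories.

Definition comodcat (k : comPzRingType) (A : kalg k) (C : coring A) : category.
Proof.
refine (@Category (comod C) (@chom k A C) (@chom_id k A C) (@chom_comp k A C) _ _ _);
  by move=> *; apply: chom_ext.
Defined.

Section TensorFunctor.
Variables (k : comPzRingType) (R S : kalg k) (N : bimod R S).

Definition tens_map (M M' : rmodType R) (f : {linear M -> M'}) :
    {linear tens M N -> tens M' N} :=
  mklinear (tmap_rlin (linear_rlin f) (id_llin N) (fun _ _ => erefl)).

Definition tens_functor : functor (modcat R) (modcat S).
Proof.
refine (@Functor (modcat R) (modcat S) (fun M => tens M N) tens_map _ _).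
- move=> M; apply: linear_ext; apply: (@tensor_ext _ M N) => [x y|//|x n] /=.
    exact: tmapD.
  by rewrite tmapE.
- move=> M M' M'' g f; apply: linear_ext.
  apply: (@tensor_ext _ M N) => [x y|x y|x n] /=.
  + by rewrite tmapD //; exact: comp_rlin.
  + by rewrite !tmapD.
  + by rewrite !tmapE //; exact: comp_rlin.
Defined.
End TensorFunctor.

(* A right L-action making the A-coring C an A-L bimodule. *)
Record ext_action (k : comPzRingType) (A L : kalg k) (C : coring A) := ExtAction {
  ext_ract :> raction (bleft C) L;
  ext_ractZ : forall (a : A) (c : C) (l : L),
    ext_ract (a *: c) l = a *: ext_ract c l;
  ext_ract_k : forall (z : k) (c : C), kmap A z *: c = ext_ract c (kmap L z) }.
Arguments ext_action {k A} L C.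

Definition ext_bimod (k : comPzRingType) (A L : kalg k) (C : coring A)
    (e : ext_action L C) : bimod A L :=
  Bimod (ext_ractZ e) (ext_ract_k e).

(* (D : L) is a right extension of (C : A). *)
Record coring_ext (k : comPzRingType) (A L : kalg k) (C : coring A)
    (D : coring L) := CoringExt {
  ext_act : ext_action L C;
  ext_coact : coaction D (bright (ext_bimod ext_act));
  ext_coactZ : forall (a : A) (c : C),
    ext_coact (a *: c) = a *: (ext_coact c : ltens (ext_bimod ext_act) D);
  comul_ext_act : forall (c : C) (l : L),
    comul C (ext_act c l) = (comul C c : tens (bright C) (ext_bimod ext_act)) <* l;
  comul_ext_coact : forall c : C,
    tassoc (tmap (comul C : bright (ext_bimod ext_act) ->
                            tens (bright C) (ext_bimod ext_act)) id (ext_coact c))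
    = tmap id (ext_coact : ext_bimod ext_act -> ltens (ext_bimod ext_act) D)
        (comul C c) }.

Section Extension.
Variables (k : comPzRingType) (A L : kalg k) (C : coring A) (D : coring L).
Variable E : coring_ext C D.

Definition extC : bimod A L := ext_bimod (ext_act E).
Definition tauC : extC -> ltens extC D := ext_coact E.

Lemma comul_llin : llin (comul C : C -> ltens C C).
Proof. by split; [exact: (linearD (comul C)) | exact: comulZ]. Qed.
Lemma comul_ext_llin : llin (comul C : extC -> ltens C extC).
Proof. by split; [exact: (linearD (comul C)) | exact: (@comulZ _ _ C)]. Qed.
Lemma comul_ext_rlin : rlin (comul C : bright extC -> tens (bright C) extC).
Proof. by split; [exact: (linearD (comul C)) | exact: comul_ext_act]. Qed.
Lemma tauC_llin : llin tauC.
Proof. by split; [exact: (linearD (ext_coact E)) | exact: ext_coactZ]. Qed.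

Section InducedAction.
Variable M : comod C.

(* m l = m^[0] eps(m^[1] l) *)
Definition ind_act (m : M) (l : L) : M :=
  tlift (fun (m0 : M) (m1 : C) => m0 <* counit (ext_act E m1 l)) (rho m).

Lemma ind_act_balanced (X : rmodType A) l :
  tbalanced X C (fun m0 m1 => m0 <* counit (ext_act E m1 l)).
Proof.
split=> [x y c|x c d|x a c].
- exact: rscaleDl.
- by rewrite ractDl counitD rscaleDr.
- by rewrite ext_ractZ counitZ rscaleA.
Qed.

Lemma rscale_counit_balanced (X : rmodType A) :
  tbalanced X C (fun m0 m1 => m0 <* counit m1).
Proof.
split=> [x y c|x c d|x a c].
- exact: rscaleDl.
- by rewrite counitD rscaleDr.
- by rewrite counitZ rscaleA.
Qed.

(* rho is right L-linear when L acts on the last factor of M (x)_A C. *)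
Lemma coact_ind_act (m : M) (l : L) :
  rho (ind_act m l) = (rho m : tens M extC) <* l.
Proof.
pose G (X : rmodType A) (x : tensor X C) : X :=
  tlift (fun m0 m1 => m0 <* counit (ext_act E m1 l)) x.
have GD X x y : @G X (x + y) = G X x + G X y.
  exact: tliftD (ind_act_balanced X l) _ _.
have GE X x c : @G X (x ⊗ c) = x <* counit (ext_act E c l).
  exact: tlift_pure (ind_act_balanced X l).
have -> : rho (ind_act m l) = G (tens M C) (tmap rho id (rho m)).
  rewrite -[ind_act m l]/(G M (rho m)); move: (rho m).
  apply: tensor_ext => [x y|x y|x c].
  - by rewrite GD linearD.
  - by rewrite tmapD // GD.
  - by rewrite tmapE // !GE linear_rscale.
rewrite -[tmap _ _ _](@tassocK k A A M C C) coact_coassoc.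
move: (rho m); apply: (@tensor_ext _ M C) => [x y|x y|x c].
- by rewrite (tmapD _ comul_llin) // tassocVD GD.
- exact: (@tens_ractDl _ _ _ M extC).
rewrite (tmapE _ comul_llin) // [RHS](@tens_ractE _ _ _ M extC).
rewrite -[bract extC c l](@comul_counitr _ _ C) [comul C (bract extC c l)]comul_ext_act.
have cb := @rscale_counit_balanced (bright C).
move: (comul C c); apply: (@tensor_ext _ (bright C) C _
  (fun w => G (tens M C) (tassocV (x ⊗ (w : ltens C C))))
  (fun w => x ⊗ tlift (fun (c1 : bright C) (c2 : C) => c1 <* counit c2)
      ((w : tens (bright C) extC) <* l))) => [v w|v w|c1 c2].
- by rewrite [x ⊗ _]tpureDr tassocVD GD.
- rewrite [X in tlift _ X](@tens_ractDl _ _ _ (bright C) extC) (tliftD cb).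
  exact: tpureDr.
- rewrite tassocVE GE [X in tlift _ X](@tens_ractE _ _ _ (bright C) extC).
  by rewrite (tlift_pure _ _ cb) [LHS]tens_ractE.
Qed.

Lemma ind_actDl m m' l : ind_act (m + m') l = ind_act m l + ind_act m' l.
Proof. by rewrite /ind_act linearD; exact: tliftD (ind_act_balanced M l) _ _. Qed.
Lemma ind_actDr m l l' : ind_act m (l + l') = ind_act m l + ind_act m l'.
Proof.
rewrite /ind_act; move: (rho m); apply: tensor_ext => [x y|x y|x c].
- exact: tliftD (ind_act_balanced M _) _ _.
- by rewrite !(tliftD (ind_act_balanced M _)) addrACA.
- rewrite !(tlift_pure _ _ (ind_act_balanced M _)).
  by rewrite ractDr counitD rscaleDr.
Qed.
Lemma ind_actA m l l' : ind_act m (l * l') = ind_act (ind_act m l) l'.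
Proof.
rewrite [in RHS]/ind_act coact_ind_act /ind_act.
move: (rho m); apply: (@tensor_ext _ M C) => [x y|x y|x c].
- exact: tliftD (ind_act_balanced M _) _ _.
- rewrite [X in tlift _ X](@tens_ractDl _ _ _ M extC).
  exact: tliftD (ind_act_balanced M _) _ _.
- rewrite [X in _ = tlift _ X](@tens_ractE _ _ _ M extC).
  by rewrite !(tlift_pure _ _ (ind_act_balanced M _)) ractA.
Qed.
Lemma ind_act1 m : ind_act m 1 = m.
Proof.
rewrite -[RHS](coact_counit (comod_coact M)).
by apply: eq_tlift => x c; rewrite ract1.
Qed.

Definition indL : rmodType L :=
  racted (Raction ind_actDl ind_actDr ind_actA ind_act1).

Lemma coactL_rlin : rlin (rho : indL -> tens M extC).
Proof. by split; [exact: (linearD rho) | exact: coact_ind_act]. Qed.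
Definition coactL : {linear indL -> tens M extC} := mklinear coactL_rlin.

(* rho (x)_A C and M (x)_A Delta, from M (x)_A C to M (x)_A C (x)_A C *)
Lemma coact_C_rlin : rlin ((fun x => tassoc (tmap rho id x)) :
  tens M extC -> tens M (btens C extC)).
Proof.
apply: (comp_rlin (tassoc_rlin M C extC)).
exact: (tmap_rlin (N := extC) (N' := extC)).
Qed.
Definition coact_C : {linear tens M extC -> tens M (btens C extC)} :=
  mklinear coact_C_rlin.

Lemma M_comul_rlin : rlin (tmap id (comul C : extC -> ltens C extC) :
  tens M extC -> tens M (btens C extC)).
Proof.
apply: (tmap_rlin (N := extC) (N' := btens C extC)) => //.
  exact: comul_ext_llin.
exact: comul_ext_act.
Qed.
Definition M_comul : {linear tens M extC -> tens M (btens C extC)} :=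
  mklinear M_comul_rlin.
End InducedAction.

(* The functor - (x)_L D (x)_L D on right L-modules. *)
Definition tensDD : functor (modcat L) (modcat L) :=
  functor_comp (tens_functor D) (tens_functor D).

(* The diagram itself is always an equalizer (split by M (x)_A eps), so        *)
(* preservation is the condition on its image under tensDD.                   *)
Definition pure_ext : Prop := forall M : comod C,
  @is_equalizer (modcat L) _ _ _
    (fmap tensDD (coactL M : @hom (modcat L) (indL M) (tens M extC)))
    (fmap tensDD (coact_C M : @hom (modcat L) (tens M extC) (tens M (btens C extC))))
    (fmap tensDD (M_comul M : @hom (modcat L) (tens M extC) (tens M (btens C extC)))).

(* The induced D-coaction m |-> m^[0] eps(m^[1]_[0]) (x)_L m^[1]_[1].  As eps *)
(* is not right L-linear, this formula does not apply to arbitrary tensors:   *)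
(* m^[0] (x) m^[1]_[0] (x) m^[1]_[1] lies in the equalizer of the two maps    *)
(* coact_C, M_comul tensored with D, that is (for a pure extension) in the    *)
(* image of M (x)_L D under rho (x)_L D, of which (M (x)_A eps) (x)_L D is    *)
(* the inverse.  See ind_coactP.                                              *)
Definition ind_coact (M : comod C) (m : M) : tens (indL M) D :=
  xget 0 [set y : tens (indL M) D |
    tmap (coactL M) id y = tassocV (tmap id tauC (rho m))].

End Extension.

Lemma regular_rlin (R : pzRingType) (Y : rmodType R) (y : Y) : rlin ((fun r => y <* r) : (R^c)^o -> Y).
Proof.
by split=> [r r'|r r']; [exact: rscaleDr | rewrite -rscaleA].
Qed.

Section Equalizer.
Variables (R : pzRingType) (X Y Z : rmodType R).
Variables (e : {linear X -> Y}) (f g : {linear Y -> Z}).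


Lemma is_equalizer_inj : @is_equalizer (modcat R) X Y Z e f g -> injective e.
Proof.
move=> [efg eP] x x' exx'.
have [|u [_ uP]] := eP ((R^c)^o : rmodType R) (mklinear (regular_rlin (e x))).
  apply: linear_ext => r /=; rewrite -!linear_rscale.
  by have := congr1 (fun h : {linear X -> Z} => h (x <* r)) efg.
have h1 : u = mklinear (regular_rlin x).
  by apply: uP; apply: linear_ext => r /=; rewrite linear_rscale.
have h2 : u = mklinear (regular_rlin x').
  by apply: uP; apply: linear_ext => r /=; rewrite linear_rscale exx'.
have := congr1 (fun h : {linear (R^c)^o -> X} => h 1) (etrans (esym h1) h2).
by rewrite /= !rscale1.
Qed.

Lemma is_equalizer_im : @is_equalizer (modcat R) X Y Z e f g ->
  forall y, f y = g y -> exists x, e x = y.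
Proof.
move=> [efg eP] y fgy.
have [|u [uP _]] := eP ((R^c)^o : rmodType R) (mklinear (regular_rlin y)).
  by apply: linear_ext => r /=; rewrite !linear_rscale fgy.
exists (u 1); have := congr1 (fun h : {linear (R^c)^o -> Y} => h 1) uP.
by rewrite /= rscale1.
Qed.
End Equalizer.

Section InducedCoaction.
Variables (k : comPzRingType) (A L : kalg k) (C : coring A) (D : coring L).
Variables (E : coring_ext C D) (M : comod C).
Hypothesis Epure : pure_ext E.

Let comulD_llin : llin (comul D : D -> ltens D D).
Proof. by split; [exact: (linearD (comul D)) | exact: comulZ]. Qed.

Let kap (X : rmodType L) (x : tensor X D) : tensor (tens X D) D :=
  tassocV (tmap id (comul D : D -> ltens D D) x).
Let ret (X : rmodType L) (x : tensor (tens X D) D) : tensor X D :=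
  tlift (fun (y : tens X D) d => y <* counit d) x.

Let kapD X x y : @kap X (x + y) = kap x + kap y.
Proof. by rewrite /kap tmapD // tassocVD. Qed.
Let ret_balanced X : tbalanced (tens X D) D (fun y d => y <* counit d).
Proof. exact: rscale_counit_balanced. Qed.
Let retD X x y : @ret X (x + y) = ret x + ret y.
Proof. exact: tliftD (@ret_balanced X) _ _. Qed.

Let kapK X : cancel (@kap X) (@ret X).
Proof.
apply: (@tensor_ext _ _ _ _ (@ret X \o @kap X) id) => [x y|//|x d] /=.
  by rewrite kapD retD.
rewrite /kap tmapE // -[d in RHS](@comul_counitr _ _ D).
have cb := @rscale_counit_balanced _ _ D (bright D).
move: (comul D d); apply: (@tensor_ext _ (bright D) D _
  (fun w => ret (tassocV (x ⊗ (w : ltens D D))))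
  (fun w => x ⊗ tlift (fun (d1 : bright D) (d2 : D) => d1 <* counit d2) w))
  => [v w|v w|d1 d2].
- by rewrite [x ⊗ _]tpureDr tassocVD retD.
- rewrite (tliftD cb); exact: tpureDr.
- rewrite tassocVE [LHS](tlift_pure _ _ (@ret_balanced X)) (tlift_pure _ _ cb).
  exact: tens_ractE.
Qed.

Let kap_nat (X Y : rmodType L) (f : {linear X -> Y}) (x : tensor X D) :
  kap (tmap f id x) = tmap (tmap f id : tens X D -> tens Y D) id (kap x).
Proof.
have fP : rlin (tmap f id : tens X D -> tens Y D) by apply: tmap_rlin.
move: x; apply: tensor_ext => [x y|x y|x d].
- by rewrite tmapD // kapD.
- by rewrite kapD tmapD.
rewrite tmapE // /kap !tmapE // ?tmapE //.
move: (comul D d); apply: (@tensor_ext _ (bright D) D _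
  (fun w => tassocV (f x ⊗ (w : ltens D D)))
  (fun w => tmap (tmap f id : tens X D -> tens Y D) id
     (tassocV (x ⊗ (w : ltens D D))))) => [v w|v w|d1 d2].
- by rewrite [f x ⊗ _]tpureDr tassocVD.
- by rewrite [x ⊗ _]tpureDr tassocVD tmapD.
- by rewrite !tassocVE !tmapE // tmapE.
Qed.

Let ret_nat (X Y : rmodType L) (f : {linear X -> Y}) (x : tensor (tens X D) D) :
  ret (tmap (tmap f id : tens X D -> tens Y D) id x) = tmap f id (ret x).
Proof.
have fP : rlin (tmap f id : tens X D -> tens Y D) by apply: tmap_rlin.
move: x; apply: (@tensor_ext _ (tens X D) D) => [x y|x y|x d].
- by rewrite tmapD // retD.
- by rewrite retD tmapD.
- rewrite tmapE // /ret !(tlift_pure _ _ (@ret_balanced _)).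
  by rewrite (proj2 fP).
Qed.

Local Notation CL := (extC E).
Local Notation tau := (@tauC _ _ _ _ _ E).

Let z (m : M) : tens (tens M CL) D := tassocV (tmap id tau (rho m)).

Let C_rlin : rlin (tmap (coact_C E M) id :
  tens (tens M CL) D -> tens (tens M (btens C CL)) D).
Proof. exact: (tmap_rlin (N := D) (N' := D)). Qed.
Let M_rlin : rlin (tmap (M_comul E M) id :
  tens (tens M CL) D -> tens (tens M (btens C CL)) D).
Proof. exact: (tmap_rlin (N := D) (N' := D)). Qed.

Let tau2 (w : ltens C CL) : ltens (btens C CL) D :=
  tassocV (tmap id tau w).
Let theta (x : tensor M (ltens C CL)) : tensor (tens M (btens C CL)) D :=
  tassocV (tmap id tau2 x).

Let tau2D v w : tau2 (v + w) = tau2 v + tau2 w.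
Proof.
rewrite /tau2 (tmapD (id_rlin (bright C)) (tauC_llin E)).
exact: (@tassocVD _ _ _ (bright C) CL D).
Qed.
Let tau2_llin : llin tau2.
Proof.
split=> [|a w]; first exact: tau2D.
move: w; apply: (@tensor_ext _ (bright C) CL) => [v w|v w|c d].
- by rewrite [a *: _]tens_lactDr tau2D.
- by rewrite tau2D scalerDr.
rewrite tpure_scale /tau2 !(tmapE (id_rlin (bright C)) (tauC_llin E)).
move: (tau d); apply: (@tensor_ext _ (bright CL) D _
  (fun t => tassocV ((a *: (c : C) : bright C) ⊗ (t : ltens CL D)))
  (fun t => a *: (tassocV ((c : bright C) ⊗ (t : ltens CL D))
                  : ltens (btens C CL) D))) => [v w|v w|x y].
- by rewrite [_ ⊗ _]tpureDr tassocVD.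
- by rewrite [c ⊗ _]tpureDr tassocVD scalerDr.
- rewrite !tassocVE [RHS](@tens_lactE _ _ _ (btens C CL)).
  by congr (_ ⊗ _); rewrite [RHS]tens_lactE.
Qed.
Let thetaD x y : theta (x + y) = theta x + theta y.
Proof. by rewrite /theta tmapD // tassocVD. Qed.

Let theta_C (x : tensor M C) :
  tmap (coact_C E M) (id : D -> D) (tassocV (tmap id tau x)) = theta (coact_C E M x).
Proof.
have tl := tauC_llin E.
move: x; apply: tensor_ext => [x y|x y|m c].
- by rewrite tmapD // tassocVD tmapD.
- by rewrite (linearD (coact_C E M)) thetaD.
rewrite (tmapE _ tl) // [coact_C E M _]/= tmapE //.
pose S (y : tensor M C) : bright CL -> tens M (btens C CL) :=
  fun c0 => tassoc ((y : tens M C) ⊗ (c0 : C)).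
have SD y : rlin (S y).
  split=> [c0 c1|c0 l]; first by rewrite /S [_ ⊗ (_ + _)]tpureDr tassocD.
  rewrite /S -[RHS](@tassoc_rscale _ _ _ _ M C CL).
  by congr tassoc; rewrite [RHS]tens_ractE.
transitivity (tmap (S (rho m)) (id : D -> D) (tau c)).
  move: (tau c); apply: (@tensor_ext _ (bright CL) D _
    (fun t => tmap (coact_C E M) id (tassocV (m ⊗ (t : ltens CL D))))
    (fun t => tmap (S (rho m)) id t)) => [v w|v w|c0 d].
  - by rewrite [m ⊗ _]tpureDr tassocVD tmapD.
  - by rewrite tmapD.
  - by rewrite tassocVE !tmapE // [coact_C E M _]/= tmapE.
move: (rho m); apply: (@tensor_ext _ M C _
  (fun y => tmap (S y) id (tau c))
  (fun y => theta (tassoc ((y : tens M C) ⊗ c)))) => [x y|x y|m0 m1].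
- rewrite /tmap -[RHS]tliftDf; apply: eq_tlift => c0 d.
  by rewrite -[RHS]tpureDl /S [X in tassoc X](tpureDl (M := tens M C)) tassocD.
- by rewrite [X in tassoc X](tpureDl (M := tens M C)) tassocD thetaD.
rewrite tassocE /theta tmapE // /tau2 (tmapE (id_rlin (bright C)) tl).
move: (tau c); apply: (@tensor_ext _ (bright CL) D _
  (fun t => tmap (S (m0 ⊗ m1)) id t)
  (fun t => tassocV (m0 ⊗ (tassocV ((m1 : bright C) ⊗ (t : ltens CL D))
     : ltens (btens C CL) D)))) => [v w|v w|c0 d].
- by rewrite tmapD.
- rewrite (tpureDr (m1 : bright C) (v : ltens CL D) w) tassocVD.
  by rewrite [m0 ⊗ _]tpureDr tassocVD.
- by rewrite !tassocVE tmapE // /S tassocE.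
Qed.

Let theta_M (x : tensor M C) :
  tmap (M_comul E M) (id : D -> D) (tassocV (tmap id tau x)) = theta (M_comul E M x).
Proof.
have tl := tauC_llin E; have cl := comul_ext_llin E.
move: x; apply: tensor_ext => [x y|x y|m c].
- by rewrite tmapD // tassocVD tmapD.
- by rewrite (linearD (M_comul E M)) thetaD.
rewrite (tmapE _ tl) // [M_comul E M _]/= tmapE // /theta tmapE // /tau2.
rewrite -[tmap id tau (comul C c)]comul_ext_coact tassocK -/tau.
move: (tau c); apply: (@tensor_ext _ (bright CL) D _
  (fun t => tmap (M_comul E M) id (tassocV (m ⊗ (t : ltens CL D))))
  (fun t => tassocV (m ⊗ (tmap (comul C : bright CL -> tens (bright C) CL) id t
     : ltens (btens C CL) D)))) => [v w|v w|c0 d].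
- by rewrite [m ⊗ _]tpureDr tassocVD tmapD.
- rewrite (tmapD (comul_ext_rlin E) (id_llin D)) [m ⊗ _]tpureDr.
  by rewrite tassocVD.
- rewrite tassocVE (tmapE (comul_ext_rlin E) (id_llin D)) tmapE //.
  by rewrite [RHS](@tassocVE _ _ _ M (btens C CL)) [M_comul E M _]/= tmapE.
Qed.

Let z_eq m : tmap (coact_C E M) (id : D -> D) (z m) = tmap (M_comul E M) id (z m).
Proof.
by rewrite theta_C theta_M; congr theta; exact: (coact_coassoc (comod_coact M)).
Qed.

Let coactDD_inj : injective
  (tmap (tmap (coactL E M) id : tens (indL E M) D -> tens (tens M CL) D) (id : D -> D)).
Proof. exact: (is_equalizer_inj (Epure M)). Qed.

Lemma tmap_coactL_inj :
  injective (tmap (coactL E M) id : tensor (indL E M) D -> tensor (tens M CL) D).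
Proof.
move=> y y' e; apply: (can_inj (@kapK _)); apply: coactDD_inj.
by rewrite -!kap_nat e.
Qed.

Lemma ind_coactP m :
  tmap (coactL E M) id (ind_coact E m) = tassocV (tmap id (@tauC _ _ _ _ _ E) (rho m)).
Proof.
rewrite /ind_coact; case: xgetP => [y _ //|/(_ _)].
have [|y ey] := is_equalizer_im (Epure M) (y := kap (z m)).
  by have := congr1 (@kap _) (z_eq m); rewrite !kap_nat.
have ry : tmap (coactL E M) id (ret y) = z m.
  rewrite -ret_nat.
  by transitivity (ret (kap (z m))); [congr ret; exact: ey | exact: kapK].
by move=> /(_ (ret y) ry).
Qed.

Lemma ind_coact_uniq m (y : tens (indL E M) D) :
    tmap (coactL E M) id y = tassocV (tmap id (@tauC _ _ _ _ _ E) (rho m)) ->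
  ind_coact E m = y.
Proof. by move=> ey; apply: tmap_coactL_inj; rewrite ind_coactP. Qed.
End InducedCoaction.

(* The endomorphism algebra End^C(M), the right End^C(M)-module Hom^C(M, N)   *)
(* and the functor Hom^C(M, -).                                               *)
Section Endomorphisms.
Variables (k : comPzRingType) (A : kalg k) (C : coring A) (M : comod C).

Definition endo_sort : Type := chom M M.
HB.instance Definition _ := GRing.Zmodule.on endo_sort.
Definition endo_mul (s t : endo_sort) : endo_sort := chom_comp s t.

Lemma endo_mulA : associative endo_mul.
Proof. by move=> s t u; apply: chom_ext. Qed.
Lemma endo_mul1l : left_id (chom_id M : endo_sort) endo_mul.
Proof. by move=> s; apply: chom_ext. Qed.
Lemma endo_mul1r : right_id (chom_id M : endo_sort) endo_mul.
Proof. by move=> s; apply: chom_ext. Qed.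
Lemma endo_mulDl : left_distributive endo_mul +%R.
Proof. by move=> s t u; apply: chom_ext. Qed.
Lemma endo_mulDr : right_distributive endo_mul +%R.
Proof. by move=> s t u; apply: chom_ext => x; exact: (proj1 (chom_rlin s)). Qed.

HB.instance Definition _ := GRing.Zmodule_isPzRing.Build endo_sort
  endo_mulA endo_mul1l endo_mul1r endo_mulDl endo_mulDr.

Lemma endo_k_colinear (z : k) : colinear (fun x : M => x <* kmap A z).
Proof.
apply: colinearP => [|m].
  split=> [x y|x a]; first exact: rscaleDl.
  by rewrite -!rscaleA kmapC.
rewrite linear_rscale; move: (rho m).
apply: (@tensor_ext _ M C) => [x y|x y|x c].
- exact: tens_ractDl.
- rewrite tmapD //; split=> [u v|u a]; first exact: rscaleDl.
  by rewrite -!rscaleA kmapC.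
- rewrite [LHS]tens_ractE tmapE //; last first.
    split=> [u v|u a]; first exact: rscaleDl.
    by rewrite -!rscaleA kmapC.
  by rewrite -bimod_k -tpureA.
Qed.
Definition endo_kmap (z : k) : endo_sort := mkchom (endo_k_colinear z).

Lemma endo_kmap_zmod : zmod_morphism endo_kmap.
Proof.
move=> y z; apply: chom_ext => x /=.
by rewrite rmorphB; exact: scalerBl.
Qed.
Lemma endo_kmap_monoid : monoid_morphism endo_kmap.
Proof.
split=> [|y z]; apply: chom_ext => x /=.
  by rewrite rmorph1 rscale1.
by rewrite rmorphM kmapC rscaleA.
Qed.
HB.instance Definition _ :=
  GRing.isZmodMorphism.Build k endo_sort endo_kmap endo_kmap_zmod.
HB.instance Definition _ :=
  GRing.isMonoidMorphism.Build k endo_sort endo_kmap endo_kmap_monoid.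

Lemma endo_kmapC (z : k) (t : endo_sort) : endo_kmap z * t = t * endo_kmap z.
Proof.
by apply: chom_ext => x; exact/esym/(proj2 (chom_rlin t)).
Qed.

Definition endo : kalg k := Kalg endo_kmapC.

Section HomModule.
Variable N : comod C.

Lemma hom_actDl (f g : chom M N) (t : endo) :
  chom_comp (f + g) t = chom_comp f t + chom_comp g t.
Proof. exact: chom_ext. Qed.
Lemma hom_actDr (f : chom M N) (s t : endo) :
  chom_comp f (s + t : endo) = chom_comp f s + chom_comp f t.
Proof. by apply: chom_ext => x; exact: (proj1 (chom_rlin f)). Qed.
Lemma hom_actA (f : chom M N) (s t : endo) :
  chom_comp f (s * t : endo) = chom_comp (chom_comp f s) t.
Proof. exact: chom_ext. Qed.
Lemma hom_act1 (f : chom M N) : chom_comp f (1 : endo) = f.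
Proof. exact: chom_ext. Qed.

Definition hom_mod : rmodType endo :=
  racted (Raction hom_actDl hom_actDr hom_actA hom_act1).
End HomModule.

Lemma hom_map_rlin (N P : comod C) (g : chom N P) :
  rlin (@chom_comp _ _ _ M N P g : hom_mod N -> hom_mod P).
Proof.
split=> [f f'|f t]; last exact: chom_ext.
by apply: chom_ext => x; exact: (proj1 (chom_rlin g)).
Qed.

Definition hom_functor : functor (comodcat C) (modcat endo).
Proof.
refine (@Functor (comodcat C) (modcat endo) hom_mod
  (fun N P g => mklinear (hom_map_rlin g)) _ _).
- by move=> N; apply: linear_ext => f; apply: chom_ext.
- by move=> N P Q h g; apply: linear_ext => f; apply: chom_ext.
Defined.
End Endomorphisms.

Record bicomod (k : comPzRingType) (A L : kalg k) (C : coring A) := Bicomod {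
  bc_bimod :> bimod L A;
  bc_coact : coaction C (bright bc_bimod);
  bc_coactZ : forall (l : L) (x : bc_bimod),
    bc_coact (l *: x) = l *: (bc_coact x : ltens bc_bimod C) }.
Arguments bicomod {k A} L C.

Section Bicomodule.
Variables (k : comPzRingType) (A L : kalg k) (C : coring A) (S : bicomod L C).

Definition bc_comod : comod C := Comod (bc_coact S).
Local Notation T := (endo bc_comod).

(* The ring map L -> T, l |-> (x |-> l x). *)
Lemma lring_colinear (l : L) :
  colinear ((fun x : S => l *: x) : bc_comod -> bc_comod).
Proof.
have fP : rlin ((fun x : S => l *: x) : bc_comod -> bc_comod).
  by split=> [x y|x a]; 
    [exact: (@scalerDr _ (bleft S)) | exact: (esym (@bractZ _ _ _ S l x a))].
apply: colinearP => // x; rewrite [LHS](bc_coactZ l x).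
by move: (bc_coact S x); apply: tensor_ext => [y y'|y y'|y c];
  [exact: tens_lactDr | rewrite tmapD | rewrite [LHS]tens_lactE tmapE].
Qed.
Definition lring (l : L) : T := mkchom (lring_colinear l).

Lemma lring_zmod : zmod_morphism lring.
Proof. by move=> l l'; apply: chom_ext => x; exact: (@scalerBl _ (bleft S)). Qed.
Lemma lring_monoid : monoid_morphism lring.
Proof.
split=> [|l l']; apply: chom_ext => x; first exact: (@scale1r _ (bleft S)).
exact: (esym (@scalerA _ (bleft S) l l' x)).
Qed.

(* Sigma as a T-A bimodule *)
Lemma ev_A (s t : T) (x : S) : s (t x) = (s * t : T) x. Proof. by []. Qed.
Lemma ev_1 (x : S) : (1 : T) x = x. Proof. by []. Qed.
Lemma ev_Dr (t : T) (x y : S) : t (x + y) = t x + t y :> S.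
Proof. exact: (proj1 (chom_rlin t)). Qed.
Lemma ev_Dl (x : S) (s t : T) : (s + t : T) x = s x + t x :> S.
Proof. by []. Qed.

Definition ev_zmod : zmodType := bleft S.
Definition ev_mod : lmodType T :=
  HB.pack (GRing.Zmodule.sort ev_zmod)
    (GRing.Zmodule_isLmodule.Build T ev_zmod ev_A ev_1 ev_Dr ev_Dl).

Lemma ev_bractZ (t : T) (x : ev_mod) (a : A) :
  bract S (t *: x) a = t *: (bract S x a : ev_mod).
Proof. exact/esym/(proj2 (chom_rlin t)). Qed.
Lemma ev_k (z : k) (x : ev_mod) : kmap T z *: x = bract S x (kmap A z).
Proof. by []. Qed.
Definition ev_bimod : bimod T A := @Bimod k T A ev_mod (bract S) ev_bractZ ev_k.

(* The functor - (x)_T Sigma; the coaction of N (x)_T Sigma is N (x)_T rho. *)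
Section TensorComodule.
Variable N : rmodType T.

Definition evt_coact (y : tens N ev_bimod) : tens (tens N ev_bimod) C :=
  tassocV (tmap id (bc_coact S : ev_bimod -> ltens ev_bimod C) y).

Lemma ev_coact_llin : llin (bc_coact S : ev_bimod -> ltens ev_bimod C).
Proof.
split=> [x y|t x]; first exact: (linearD (bc_coact S)).
rewrite [LHS](chom_coact t) -/bc_comod.
move: (bc_coact S x); apply: (@tensor_ext _ (bright S) C) => [y y'|y y'|y c].
- exact: (tmapD (chom_rlin t) (id_llin _)).
- exact: (@tens_lactDr _ _ _ ev_bimod).
- by rewrite tmapE // [RHS](@tens_lactE _ _ _ ev_bimod).
Qed.

Lemma evt_coact_rlin : rlin evt_coact.
Proof.
apply: (comp_rlin (tassocV_rlin N ev_bimod C)).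
apply: (tmap_rlin (N := ev_bimod) (N' := btens ev_bimod C)) => //.
  exact: ev_coact_llin.
move=> x a; exact: (linear_rscale (bc_coact S)).
Qed.

Definition evt_in (n : N) : bright ev_bimod -> tens N ev_bimod := fun x => n ⊗ x.

Lemma evt_in_rlin n : rlin (evt_in n).
Proof.
split=> [x y|x a]; first exact: (@tpureDr _ N ev_bimod).
exact/esym/(@tens_ractE _ _ _ N ev_bimod).
Qed.
Hint Resolve evt_in_rlin : core.

Lemma evt_inE n (y : tensor (bright ev_bimod) C) :
  tassocV (n ⊗ (y : ltens ev_bimod C)) = tmap (evt_in n) id y.
Proof.
move: y; apply: (@tensor_ext _ (bright ev_bimod) C _
  (fun y => tassocV (n ⊗ (y : ltens ev_bimod C)))) => [x y|x y|x c].
- by rewrite [n ⊗ _]tpureDr tassocVD.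
- by rewrite tmapD.
- by rewrite tassocVE tmapE.
Qed.

Lemma evt_coactE (n : N) (x : S) :
  evt_coact (n ⊗ (x : ev_mod)) = tmap (evt_in n) id (bc_coact S x).
Proof. by rewrite /evt_coact (tmapE _ ev_coact_llin) // evt_inE. Qed.

Lemma evt_coactD x y : evt_coact (x + y) = evt_coact x + evt_coact y.
Proof. exact: (proj1 evt_coact_rlin). Qed.

Lemma evt_coassoc (y : tens N ev_bimod) :
  tassoc (tmap evt_coact id (evt_coact y))
  = tmap id (comul C : C -> ltens C C) (evt_coact y).
Proof.
have cl : llin (comul C : C -> ltens C C).
  by split; [exact: (linearD (comul C)) | exact: comulZ].
have el := evt_coact_rlin.
move: y; apply: (@tensor_ext _ N ev_bimod) => [x y|x y|n x].
- by rewrite [X in tmap _ _ X]evt_coactD tmapD // tassocD.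
- by rewrite [X in tmap _ _ X]evt_coactD tmapD.
pose Phi (w : tensor (bright S) (ltens C C)) :
  tensor (tens N ev_bimod) (ltens C C) := tmap (evt_in n) id w.
have PhiD v w : Phi (v + w) = Phi v + Phi w by exact: (tmapD (evt_in_rlin n)).
rewrite evt_coactE.
transitivity (Phi (tassoc (tmap (bc_coact S) id (bc_coact S x)))).
  move: (bc_coact S x); apply: (@tensor_ext _ (bright S) C) => [r s|r s|x' c].
  - by rewrite (tmapD (evt_in_rlin n)) // tmapD // tassocD.
  - by rewrite tmapD // tassocD PhiD.
  rewrite (tmapE (evt_in_rlin n)) // tmapE // [evt_coact _]evt_coactE tmapE //.
  move: (bc_coact S x'); apply: (@tensor_ext _ (bright S) C _
    (fun w => tassoc ((tmap (evt_in n) id w : tens (tens N ev_bimod) C) ⊗ c))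
    (fun w => Phi (tassoc ((w : tens (bright S) C) ⊗ c)))) => [v w|v w|x0 c0].
  - rewrite (tmapD (evt_in_rlin n)) //.
    by rewrite [X in tassoc X](tpureDl (M := tens (tens N ev_bimod) C)) tassocD.
  - rewrite [X in tassoc X](tpureDl (M := tens (bright S) C)) tassocD.
    exact: PhiD.
  - rewrite (tmapE (evt_in_rlin n)) // !tassocE /Phi.
    by rewrite [RHS](tmapE (evt_in_rlin n)).
rewrite (coact_coassoc (bc_coact S)).
move: (bc_coact S x); apply: (@tensor_ext _ (bright S) C) => [r s|r s|x' c].
- by rewrite tmapD // PhiD.
- by rewrite (tmapD (evt_in_rlin n)) // tmapD.
- rewrite tmapE // (tmapE (evt_in_rlin n)) // tmapE //.
  exact: (tmapE (evt_in_rlin n)).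
Qed.

Lemma evt_counit (y : tens N ev_bimod) :
  tlift (fun (y0 : tens N ev_bimod) (c : C) => y0 <* counit c) (evt_coact y) = y.
Proof.
have cb X := @rscale_counit_balanced _ _ C X.
move: y; apply: (@tensor_ext _ N ev_bimod _ _ id) => [x y|//|n x].
  by rewrite evt_coactD (tliftD (cb _)).
rewrite evt_coactE -[x in RHS](coact_counit (bc_coact S)).
move: (bc_coact S x); apply: (@tensor_ext _ (bright S) C _ _
  (fun r => n ⊗ (tlift (fun (x0 : bright S) (c : C) => x0 <* counit c) r : ev_mod)))
  => [r s|r s|x' c].
- by rewrite (tmapD (evt_in_rlin n)) // (tliftD (cb _)).
- rewrite (tliftD (cb _)); exact: (@tpureDr _ N ev_mod).
- rewrite (tmapE (evt_in_rlin n)) // !(tlift_pure _ _ (cb _)).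
  exact: (@tens_ractE _ _ _ N ev_bimod).
Qed.

Definition evt_coaction : coaction C (tens N ev_bimod) :=
  @Coaction k A C (tens N ev_bimod) (mklinear evt_coact_rlin)
    evt_coassoc evt_counit.
Definition evt_comod : comod C := Comod evt_coaction.
End TensorComodule.

Lemma evt_map_colinear (N N' : rmodType T) (f : {linear N -> N'}) :
  colinear (tmap f id : evt_comod N -> evt_comod N').
Proof.
have fP : rlin (tmap f id : tens N ev_bimod -> tens N' ev_bimod).
  exact: tmap_rlin.
apply: colinearP => // y.
move: y; apply: (@tensor_ext _ N ev_bimod _
  (fun y => evt_coact (tmap f id y)) (fun y => tmap _ id (evt_coact y)))
  => [x y|x y|n x].
- by rewrite tmapD // [LHS]evt_coactD.
- by rewrite evt_coactD tmapD.
rewrite tmapE // !evt_coactE.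
move: (bc_coact S x); apply: (@tensor_ext _ (bright S) C) => [r s|r s|x' c].
- exact: (tmapD (evt_in_rlin (f n))).
- by rewrite (tmapD (evt_in_rlin n)) // tmapD.
- rewrite (tmapE (evt_in_rlin n)) // (tmapE (evt_in_rlin (f n))) // tmapE //.
  by congr (_ ⊗ _); rewrite [RHS]tmapE.
Qed.

Definition evt_functor : functor (modcat T) (comodcat C).
Proof.
refine (@Functor (modcat T) (comodcat C) evt_comod
  (fun N N' f => mkchom (evt_map_colinear f)) _ _).
- move=> N; apply: chom_ext => y /=.
  move: y; apply: (@tensor_ext _ N ev_bimod _ _ id) => [x y|//|n x].
    exact: tmapD.
  by rewrite tmapE.
- move=> N N' N'' g f; apply: chom_ext => y /=.
  move: y; apply: (@tensor_ext _ N ev_bimod) => [x y|x y|n x].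
  + by rewrite tmapD //; exact: comp_rlin.
  + by rewrite !tmapD.
  + by rewrite !tmapE //; exact: comp_rlin.
Defined.
End Bicomodule.

Section Cleft.
Variables (k : comPzRingType) (A L : kalg k) (C : coring A) (D : coring L).
Variables (E : coring_ext C D) (S : bicomod L C).
Local Notation T := (endo (bc_comod S)).

(* Left L-linear right D-colinear maps D -> Sigma, where Sigma carries the    *)
(* induced right L-action and right D-coaction. *)
Record is_LHomD (p : D -> S) : Prop := {
  LHomD_add : forall d d', p (d + d') = p d + p d';
  LHomD_Z : forall (l : L) d, p (l *: d) = l *: p d;
  LHomD_bract : forall d (l : L),
    p (bract D d l) = ind_act E (p d : bc_comod S) l;
  LHomD_coact : forall d : D,
    ind_coact E (p d : bc_comod S)
    = tmap (p : bright D -> indL E (bc_comod S)) id (comul D d) }.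

(* L-bimodule maps D -> T *)
Record is_LHomL (v : D -> T) : Prop := {
  LHomL_add : forall d d', v (d + d') = v d + v d';
  LHomL_Z : forall (l : L) d, v (l *: d) = lring S l * v d;
  LHomL_bract : forall d (l : L), v (bract D d l) = v d * lring S l }.

(* Sigma^* = Hom_A(Sigma, A): in the right A-module (A^c)^o, a acts on b to   *)
(* give b * a.  Its A-L bimodule structure (a xi l)(x) = a xi(l x) is written *)
(* out in Qtilde_Z and Qtilde_bract.                                          *)
Definition dual : Type := {linear bright S -> (A^c)^o}.
Definition dual_ev (xi : dual) (x : S) : A := xi x.

Record is_Qtilde (q : C -> dual) : Prop := {
  Qtilde_add : forall c d x, dual_ev (q (c + d)) x = dual_ev (q c) x + dual_ev (q d) x;
  Qtilde_Z : forall (a : A) c x, dual_ev (q (a *: c)) x = a * dual_ev (q c) x;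
  Qtilde_bract : forall c (l : L) x,
    dual_ev (q (bract (extC E) c l)) x = dual_ev (q c) (l *: x);
  Qtilde_colin : forall (x : S) (c : C),
    tlift (fun (c1 : bright C) (c2 : C) => c1 <* dual_ev (q c2) x) (comul C c)
    = tlift (fun (x0 : bright S) (x1 : C) => dual_ev (q c) x0 *: x1)
        (bc_coact S x) }.

Definition bullet (q : C -> dual) (p : D -> S) (c : C) : C :=
  tlift (fun (c0 : bright (extC E)) (c1 : D) =>
    tlift (fun (x0 : bright S) (x1 : C) => dual_ev (q c0) x0 *: x1)
      (bc_coact S (p c1)))
    (tauC (E := E) c).

Definition lozenge (p : D -> S) (q : C -> dual) (d : D) (y : S) : S :=
  tlift (fun (x0 : bright S) (x1 : C) => x0 <* dual_ev (q x1) y)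
    (bc_coact S (p d)).

(* The Sweedler expressions above are well defined. *)
Lemma dual_evD xi x y : dual_ev xi (x + y) = dual_ev xi x + dual_ev xi y.
Proof. exact: (linearD xi). Qed.
Lemma dual_ev_bract xi x (a : A) : dual_ev xi (bract S x a) = dual_ev xi x * a.
Proof. exact: (linearZ_LR xi). Qed.

Lemma Qtilde_balancedl q x : is_Qtilde q ->
  tbalanced (bright C) C (fun c1 c2 => c1 <* dual_ev (q c2) x).
Proof.
case=> qD qZ _ _; split=> [c c' d|c d d'|c a d].
- exact: rscaleDl.
- by rewrite qD rscaleDr.
- by rewrite qZ rscaleA.
Qed.
Lemma Qtilde_balancedr xi :
  tbalanced (bright S) C (fun x0 x1 => dual_ev xi x0 *: x1).
Proof.
split=> [x y c|x c d|x a c].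
- by rewrite dual_evD scalerDl.
- exact: scalerDr.
- by rewrite dual_ev_bract scalerA.
Qed.
Lemma bullet_balanced q p : is_Qtilde q -> is_LHomD p ->
  tbalanced (bright (extC E)) D (fun c0 c1 =>
    tlift (fun (x0 : bright S) (x1 : C) => dual_ev (q c0) x0 *: x1)
      (bc_coact S (p c1))).
Proof.
move=> [qD qZ ql _] [pD pZ _ _]; split=> [c c' d|c d d'|c l d].
- by rewrite -tliftDf; apply: eq_tlift => x e; rewrite qD scalerDl.
- by rewrite pD linearD; exact: (tliftD (Qtilde_balancedr _)).
- rewrite pZ bc_coactZ; move: (bc_coact S (p d)).
  apply: (@tensor_ext _ (bright S) C) => [x y|x y|x e].
  + exact: (tliftD (Qtilde_balancedr _)).
  + rewrite scalerDr; exact: (tliftD (Qtilde_balancedr _)).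
  + rewrite [X in _ = tlift _ X]tens_lactE.
    by rewrite !(tlift_pure _ _ (Qtilde_balancedr _)) ql.
Qed.
Lemma lozenge_balanced q y : is_Qtilde q ->
  tbalanced (bright S) C (fun x0 x1 => x0 <* dual_ev (q x1) y).
Proof.
case=> qD qZ _ _; split=> [c c' d|c d d'|c a d].
- exact: rscaleDl.
- by rewrite qD rscaleDr.
- by rewrite qZ rscaleA.
Qed.

Definition cleft : Prop := exists (j : D -> S) (jt : C -> dual),
  [/\ is_LHomD j, is_Qtilde jt,
      forall c, bullet jt j c = c &
      forall d y, lozenge j jt d y = (lring S (counit d) : T) y].
End Cleft.

(* Main.v *)
Require Import Defs.
From mathcomp Require Import all_boot all_algebra.

(** The tensor functor F = - (x)_T S is left adjoint to H = Hom^C(S, -), with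
    counit the evaluation H M (x)_T S -> M, f (x) x |-> f x, and unit
    N -> H (N (x)_T S), n |-> (x |-> n (x) x).  The proof inverts both by hand.

    Counit.  An element q of Q~ turns every m in a comodule M into a colinear
    map [transl m] : S -> M, x |-> m^0 q(m^1)(x), and m |-> [transl m] is
    natural in M and right L-linear.  Purity of the extension makes M a
    D-comodule, so that for a left L-linear j : D -> S there is the map
    [uneval] : M -> H M (x)_T S, m |-> transl m_[0] (x) j m_[1].
    Evaluating it gives m^0 eps((q . j)(m^1)), which is m as soon as
    q . j is the identity of C ([unevalK]).  In the other order, colinear maps
    f : S -> M are D-colinear, so uneval (f x) = f o transl x_[0] (x) j x_[1]
    = f (x) (transl x_[0])(j x_[1]) = f (x) x, by the case M = S of the first
    identity ([evalK]).  Since evaluation is bijective, every comodule is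
    generated by the images of colinear maps from S, and H is fully faithful
    ([hom_fully_faithful]).

    Unit.  An L-bimodule map v : D -> T gives the left T-linear map
    [to_endo v] : S -> T, x |-> transl x_[0] o v x_[1]; because j <> q is
    eps_D(-) 1_T, its composite with j is v ([to_endo_section]).  Hence
    sum v_i(d_i) = 1 yields left T-linear maps w_i : S -> T and elements
    s_i = j d_i of S with sum w_i(s_i) = 1, which says that S generates the
    category of left T-modules.  For any such S with bijective evaluation,
    the unit is bijective too ([pureCK], [unpureK]): the formula
    f |-> sum_i (N (x) w_i)(f s_i) is a left inverse of the unit, natural
    in N, and naturality along the unit itself turns it into a right
    inverse. *)

Import GRing.Theory.
Local Open Scope ring_scope.

Set Implicit Arguments.
Unset Strict Implicit.
Unset Printing Implicit Defensive.

(** * Colinear maps out of S obtained from an element of Q~ *)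

Section Contraction.
Variables (k : comPzRingType) (A L : kalg k) (C : coring A) (D : coring L).
Variables (E : coring_ext C D) (S : bicomod L C).
Variables (q : C -> dual S) (qP : is_Qtilde E q).

Lemma contract_balanced (X : rmodType A) (x : S) :
  tbalanced X C (fun m c => m <* dual_ev (q c) x).
Proof.
case: qP => qD qZ _ _; split=> [m m' c|m c c'|m a c].
- exact: rscaleDl.
- by rewrite qD rscaleDr.
- by rewrite qZ rscaleA.
Qed.

Definition contract (X : rmodType A) (x : S) (w : tensor X C) : X :=
  tlift (fun m c => m <* dual_ev (q c) x) w.

Lemma contractE (X : rmodType A) x m c :
  @contract X x (m ⊗ c) = m <* dual_ev (q c) x.
Proof. exact: tlift_pure (contract_balanced X x). Qed.

Lemma contractD (X : rmodType A) x v w :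
  @contract X x (v + w) = contract x v + contract x w.
Proof. exact: tliftD (contract_balanced X x) v w. Qed.

Lemma contract_rlin (X : rmodType A) (w : tensor X C) :
  rlin ((fun x => contract x w) : bright S -> X).
Proof.
split=> [x y|x a].
- rewrite /contract -[RHS]tliftDf; apply: eq_tlift => m c.
  by rewrite [dual_ev _ _]dual_evD rscaleDr.
- move: w; apply: (@tensor_ext _ X C) => [v w|v w|m c].
  + exact: contractD.
  + by rewrite contractD rscaleDl.
  + by rewrite !contractE [dual_ev _ _]dual_ev_bract rscaleA.
Qed.

Lemma contract_nat (X Y : rmodType A) (f : X -> Y) x (w : tensor X C) :
  rlin f -> contract x (tmap f id w) = f (contract x w).
Proof.
move=> fP; move: w; apply: tensor_ext => [v w|v w|m c].
- by rewrite tmapD // contractD.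
- by rewrite contractD (proj1 fP).
- by rewrite tmapE // !contractE (proj2 fP).
Qed.

Section Translation.
Variable M : comod C.

(** By coassociativity the coaction of m^0 q(m^1)(x) is
    m^0 (x) m^1 q(m^2)(x), and the defining property of Q~ rewrites this as
    m^0 q(m^1)(x^0) (x) x^1. *)
Lemma contract_coact_colinear (m : M) :
  colinear ((fun x => contract x (rho m)) : bc_comod S -> M).
Proof.
apply: colinearP => [|x]; first exact: contract_rlin.
rewrite -[LHS](contract_nat (f := rho)) //.
rewrite -[tmap _ _ _](@tassocK k A A M C C) coact_coassoc.
move: (rho m); apply: (@tensor_ext _ M C) => [v w|v w|m0 c].
- by rewrite (tmapD _ (comul_llin C)) // tassocVD contractD.
- rewrite /tmap -[RHS]tliftDf; apply: eq_tlift => x0 x1.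
  by rewrite contractD tpureDl.
rewrite (tmapE _ (comul_llin C)) //.
transitivity (m0 ⊗ contract x (comul C c : tensor (bright C) C)).
  move: (comul C c); apply: (@tensor_ext _ (bright C) C _
    (fun w => contract x (tassocV (m0 ⊗ (w : ltens C C))))
    (fun w => m0 ⊗ (contract x w : C))) => [v w|v w|c1 c2].
  + by rewrite [m0 ⊗ _]tpureDr tassocVD contractD.
  + by rewrite contractD; exact: tpureDr.
  + by rewrite tassocVE !contractE; exact: tens_ractE.
rewrite [contract _ _](Qtilde_colin qP).
have bb := Qtilde_balancedr (q c).
have rl := contract_rlin (m0 ⊗ c : tensor M C).
move: (comod_coact _ x); apply: (@tensor_ext _ (bright S) C _
  (fun w => m0 ⊗ (tlift (fun (x0 : bright S) x1 => dual_ev (q c) x0 *: x1) w : C))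
  (fun w => tmap _ id w)) => [v w|v w|x0 x1].
- rewrite (tliftD bb); exact: tpureDr.
- exact: tmapD.
- by rewrite (tlift_pure _ _ bb) tmapE // contractE tpureA.
Qed.

Definition transl (m : M) : chom (bc_comod S) M :=
  mkchom (contract_coact_colinear m).

Lemma translE m x : transl m x = contract x (rho m).
Proof. by []. Qed.

Lemma translD m m' : transl (m + m') = transl m + transl m'.
Proof. by apply: chom_ext => x; rewrite translE linearD contractD. Qed.

(** Reflects the right L-linearity of q, since the coaction of M intertwines
    the induced L-action on M with the L-action on C. *)
Lemma transl_act m (l : L) :
  transl (ind_act E m l) = chom_comp (transl m) (lring S l).
Proof.
apply: chom_ext => x; rewrite translE coact_ind_act.
rewrite [RHS]/=; move: (rho m); apply: (@tensor_ext _ M C) => [v w|v w|m0 c].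
- rewrite [X in contract _ X](@tens_ractDl _ _ _ M (extC E)); exact: contractD.
- exact: contractD.
- rewrite [X in contract _ X](@tens_ractE _ _ _ M (extC E)) !contractE.
  by rewrite (Qtilde_bract qP).
Qed.
End Translation.

Lemma transl_nat (M N : comod C) (f : chom M N) m :
  transl (f m) = chom_comp f (transl m).
Proof. by apply: chom_ext => x; rewrite translE chom_coact contract_nat. Qed.

End Contraction.

(** * The counit and the unit of the adjunction *)

Section Evaluation.
Variables (k : comPzRingType) (A L : kalg k) (C : coring A) (S : bicomod L C).
Local Notation T := (endo (bc_comod S)).
Local Notation Hom := (hom_mod (bc_comod S)).

Section Counit.
Variable M : comod C.

Lemma eval_balanced :
  tbalanced (Hom M) (ev_mod S) (fun (f : Hom M) (x : ev_mod S) => (f : chom (bc_comod S) M) x : M).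
Proof.
split=> [//|f x y|//].
exact: (proj1 (chom_rlin f)).
Qed.

Definition eval (y : evt_comod (Hom M)) : M :=
  tlift (fun (f : Hom M) (x : ev_mod S) => (f : chom (bc_comod S) M) x : M)
    (y : tensor (Hom M) (ev_mod S)).

Lemma evalE (f : chom (bc_comod S) M) (x : S) :
  eval ((f : Hom M) ⊗ (x : ev_mod S)) = f x.
Proof. exact: tlift_pure eval_balanced. Qed.

Lemma evalD x y : eval (x + y) = eval x + eval y.
Proof. exact: tliftD eval_balanced x y. Qed.

Lemma eval_rlin : rlin eval.
Proof.
split=> [|y a]; first exact: evalD.
move: y; apply: (@tensor_ext _ (Hom M) (ev_mod S) _
  (fun y => eval ((y : evt_comod (Hom M)) <* a)) (fun y => eval y <* a))
  => [x y|x y|f x].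
- by rewrite [X in eval X]tens_ractDl evalD.
- by rewrite evalD rscaleDl.
- rewrite [X in eval X](@tens_ractE _ _ _ (Hom M) (ev_bimod S)) !evalE.
  exact: (proj2 (chom_rlin f)).
Qed.

Lemma eval_colinear : colinear eval.
Proof.
apply: colinearP => [|y]; first exact: eval_rlin.
have eP := eval_rlin.
move: y; apply: (@tensor_ext _ (Hom M) (ev_mod S) _
  (fun y => rho (eval y)) (fun y => tmap eval id (evt_coact y))) => [x y|x y|f x].
- by rewrite evalD linearD.
- by rewrite evt_coactD tmapD.
rewrite evalE evt_coactE chom_coact.
move: (bc_coact S x); apply: (@tensor_ext _ (bright S) C) => [v w|v w|x0 c].
- exact: (tmapD (chom_rlin f)).
- by rewrite (tmapD (evt_in_rlin _)) // tmapD.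
- rewrite (tmapE (chom_rlin f)) // (tmapE (evt_in_rlin _)) // tmapE //.
  by rewrite /evt_in evalE.
Qed.
Definition evalC : chom (evt_comod (Hom M)) M := mkchom eval_colinear.
End Counit.

Lemma eval_nat (M N : comod C) (g : chom M N) y :
  eval (tmap (chom_comp g : Hom M -> Hom N) id y) = g (eval y).
Proof.
have gP : rlin (chom_comp g : Hom M -> Hom N) by exact: hom_map_rlin.
move: y; apply: (@tensor_ext _ (Hom M) (ev_mod S)) => [x y|x y|f x].
- by rewrite tmapD // evalD.
- by rewrite evalD (proj1 (chom_rlin g)).
- by rewrite tmapE // !evalE.
Qed.

Lemma colinear_can (M N : comod C) (f : chom M N) (g : N -> M) :
  cancel f g -> cancel g f -> colinear g.
Proof.
move=> fK gK; have [fD fZ] := chom_rlin f.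
have gP : rlin g.
  split=> [x y|x a]; apply: (can_inj fK); first by rewrite fD !gK.
  by rewrite fZ !gK.
apply: colinearP => // n; rewrite -{2}(gK n) chom_coact.
move: (rho (g n)); apply: (@tensor_ext _ _ _ _ id) => [//|x y|m c].
- by rewrite !tmapD.
- by rewrite !tmapE // fK.
Qed.

Section Unit.
Variable N : rmodType T.

Lemma pure_colinear (n : N) :
  colinear ((fun x => evt_in n x) : bc_comod S -> evt_comod N).
Proof.
apply: colinearP => [|x]; first exact: evt_in_rlin.
exact: evt_coactE.
Qed.
Definition pureC (n : N) : chom (bc_comod S) (evt_comod N) :=
  mkchom (pure_colinear n).

Lemma pureC_rlin : rlin (pureC : N -> Hom (evt_comod N)).
Proof.
split=> [n n'|n t]; apply: chom_ext => x.
  exact: (@tpureDl _ N (ev_mod S)).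
exact: (@tpureA _ N (ev_mod S)).
Qed.
End Unit.

(** * Consequences of the bijectivity of the counit *)

Section FullyFaithful.
Hypothesis evalB : forall M : comod C, bijective (@eval M).

(** A T-linear g : H X -> H Y is induced by eval o (g (x)_T S) o eval^-1; it is
    induced by at most one map because every element of X is a sum of values
    of colinear maps S -> X. *)
Lemma hom_fully_faithful : fully_faithful (hom_functor (bc_comod S)).
Proof.
move=> X Y g; have [b eK bK] := evalB X.
pose bC : chom X (evt_comod (Hom X)) := mkchom (colinear_can (f := evalC X) eK bK).
exists (chom_comp (evalC Y) (chom_comp (fmap (evt_functor S) g) bC)); split.
  apply: linear_ext => h; apply: chom_ext => x.
  rewrite [LHS]/= -[X in b X]evalE eK tmapE //.
  exact: evalE.
move=> f' <-; apply: chom_ext => m.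
by rewrite /= eval_nat bK.
Qed.
End FullyFaithful.

Section Equivalence.
Hypothesis evalB : forall M : comod C, bijective (@eval M).
(* The maps w and elements s witness that S is a generator of the category of
   left T-modules. *)
Variables (n : nat) (w : 'I_n -> S -> T) (s : 'I_n -> S).
Hypothesis wD : forall i x y, w i (x + y) = w i x + w i y.
Hypothesis wZ : forall i (t : T) x, w i (t x) = t * w i x.
Hypothesis ws : \sum_i w i (s i) = 1.

Section Retraction.
Variable N : rmodType T.

Lemma mulw_balanced i : tbalanced N (ev_mod S) (fun (m : N) (x : ev_mod S) => m <* w i x).
Proof.
split=> [m m' x|m x y|m t x].
- exact: rscaleDl.
- by rewrite wD rscaleDr.
- by rewrite -rscaleA -wZ.
Qed.

Definition unpure (f : chom (bc_comod S) (evt_comod N)) : N :=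
  \sum_i tlift (fun (m : N) (x : ev_mod S) => m <* w i x) (f (s i) : tensor N (ev_mod S)).

Lemma pureCK : cancel (@pureC N) unpure.
Proof.
move=> m; rewrite -[RHS]rscale1 -ws /rscale scaler_suml.
by apply: eq_bigr => i _; exact: tlift_pure (mulw_balanced i).
Qed.
End Retraction.

(** The equation on h' says that h' is the image of h under the functor
    H (- (x)_T S) applied to f. *)
Lemma unpure_nat (N N' : rmodType T) (f : N -> N')
    (h : chom (bc_comod S) (evt_comod N)) (h' : chom (bc_comod S) (evt_comod N')) :
  rlin f -> (forall x, h' x = tmap f id (h x : tensor N (ev_mod S))) ->
  unpure h' = f (unpure h).
Proof.
move=> fP hh'; have f0 : f 0 = 0 by apply: (addrI (f 0)); rewrite -(proj1 fP) !addr0.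
rewrite /unpure (big_morph f (proj1 fP) f0); apply: eq_bigr => i _.
rewrite hh'.
move: (h (s i)); apply: (@tensor_ext _ N (ev_mod S)) => [x y|x y|m x].
- by rewrite tmapD // (tliftD (mulw_balanced _ i)).
- by rewrite (tliftD (mulw_balanced _ i)) (proj1 fP).
- rewrite tmapE // !(tlift_pure _ _ (mulw_balanced _ i)).
  by rewrite (proj2 fP).
Qed.

(** Put N' = H (N (x)_T S) and let eta be the unit.  For f in N' the colinear
    maps (eta_N (x)_T S) o f and eta_N' f from S to N' (x)_T S coincide, as
    both become f after evaluation, which is injective.  Naturality of
    [unpure] along eta_N thus gives
    eta_N (unpure f) = unpure (eta_N' f) = f. *)
Lemma unpureK N : cancel (@unpure N) (@pureC N).
Proof.
move=> f; have [b eK bK] := evalB (evt_comod N).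
rewrite -[RHS](@pureCK (Hom (evt_comod N))).
apply/esym/(unpure_nat (pureC_rlin N)) => x.
apply: (can_inj eK); rewrite [eval _]evalE.
move: (f x); apply: (@tensor_ext _ N (ev_mod S) _ id) => [//|y z|m y].
- by rewrite (tmapD (pureC_rlin N)) // evalD.
- by rewrite (tmapE (pureC_rlin N)) // evalE.
Qed.

Lemma unpure_rlin N : rlin (@unpure N : Hom (evt_comod N) -> N).
Proof.
have [pD pZ] := pureC_rlin N.
split=> [f g|f t]; apply: (can_inj (@pureCK N)).
  by rewrite [RHS]pD !unpureK.
by rewrite [RHS]pZ !unpureK.
Qed.

Lemma generator_equivalence :
  inverse_equivalences (evt_functor S) (hom_functor (bc_comod S)).
Proof.
split.
- exists (fun N => mklinear (@unpure_rlin N)); split.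
    move=> N N' f; apply: linear_ext => h.
    exact: (unpure_nat (linear_rlin f)).
  move=> N; exists (mklinear (@pureC_rlin N)); split; apply: linear_ext => x.
    exact: unpureK.
  exact: pureCK.
- exists evalC; split.
    by move=> M N g; apply: chom_ext => y; exact: eval_nat.
  move=> M; have [b eK bK] := evalB M.
  by exists (mkchom (colinear_can (f := evalC M) eK bK)); split; apply: chom_ext.
Qed.
End Equivalence.
End Evaluation.

(** * The D-comodules induced by a pure extension *)

Section InducedCoactionTheory.
Variables (k : comPzRingType) (A L : kalg k) (C : coring A) (D : coring L).
Variables (E : coring_ext C D) (Epure : pure_ext E).

Lemma ind_coactD (M : comod C) (m m' : M) :
  ind_coact E (m + m') = ind_coact E m + ind_coact E m'.
Proof.
apply: (ind_coact_uniq Epure); rewrite tmapD // !(ind_coactP Epure).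
by rewrite linearD (tmapD _ (tauC_llin E)) // tassocVD.
Qed.

Lemma chom_ind_act (M N : comod C) (f : chom M N) m (l : L) :
  f (ind_act E m l) = ind_act E (f m) l.
Proof.
rewrite /ind_act chom_coact; have [fD fZ] := chom_rlin f.
move: (rho m); apply: (@tensor_ext _ M C) => [x y|x y|x c].
- by rewrite (tliftD (ind_act_balanced E M l)) fD.
- by rewrite tmapD // (tliftD (ind_act_balanced E N l)).
- by rewrite tmapE // !(tlift_pure _ _ (ind_act_balanced E _ l)) fZ.
Qed.

Lemma chom_indL_rlin (M N : comod C) (f : chom M N) :
  rlin (f : indL E M -> indL E N).
Proof.
by split=> [x y|x l]; [exact: (proj1 (chom_rlin f)) | exact: chom_ind_act].
Qed.

(** Both sides are determined by their images in N (x)_A C (x)_L D, where the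
    induced coaction is n |-> n^0 (x) n^1_[0] (x) n^1_[1] and the claim is the
    C-colinearity of f. *)
Lemma ind_coact_nat (M N : comod C) (f : chom M N) m :
  ind_coact E (f m) = tmap (f : indL E M -> indL E N) id (ind_coact E m).
Proof.
have fL := chom_indL_rlin f; have fP := chom_rlin f; have tl := tauC_llin E.
have ffP : rlin (tmap f id : tens M (extC E) -> tens N (extC E)).
  exact: (tmap_rlin (N := extC E) (N' := extC E)).
apply: (ind_coact_uniq Epure).
transitivity (tmap (tmap f id : tens M (extC E) -> tens N (extC E)) (id : D -> D)
  (tmap (coactL E M) id (ind_coact E m))).
  move: (ind_coact E m); apply: (@tensor_ext _ (indL E M) D) => [x y|x y|x d].
  - by rewrite (tmapD fL) // tmapD.
  - by rewrite !tmapD.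
  - rewrite (tmapE fL) // !tmapE //; congr (_ ⊗ _); exact: chom_coact.
rewrite (ind_coactP Epure) chom_coact.
move: (rho m); apply: (@tensor_ext _ M C) => [x y|x y|x c].
- by rewrite (tmapD _ tl) // tassocVD tmapD.
- by rewrite tmapD // (tmapD _ tl) // tassocVD.
rewrite (tmapE fP) // !(tmapE _ tl) //.
move: (tauC c); apply: (@tensor_ext _ (bright (extC E)) D _
  (fun t => tmap (tmap f id : tens M (extC E) -> tens N (extC E)) id
     (tassocV (x ⊗ (t : ltens (extC E) D))))
  (fun t => tassocV (f x ⊗ (t : ltens (extC E) D)))) => [v w|v w|c0 d].
- by rewrite [x ⊗ _]tpureDr tassocVD tmapD.
- by rewrite [f x ⊗ _]tpureDr tassocVD.
- by rewrite !tassocVE tmapE // tmapE.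
Qed.
End InducedCoactionTheory.

(** * The inverse of the counit, and generators, for a cleft bicomodule *)

Section CleftBicomodule.
Variables (k : comPzRingType) (A L : kalg k) (C : coring A) (D : coring L).
Variables (E : coring_ext C D) (S : bicomod L C).
Variables (j : D -> S) (q : C -> dual S).
Hypotheses (Epure : pure_ext E) (jP : is_LHomD E j) (qP : is_Qtilde E q).
Local Notation T := (endo (bc_comod S)).
Local Notation Hom := (hom_mod (bc_comod S)).


Section Inverse.
Variable M : comod C.

Lemma uneval_balanced :
  tbalanced (indL E M) D (fun (m : indL E M) (d : D) =>
    (transl qP (m : M) : Hom M) ⊗ (j d : ev_mod S) : tensor (Hom M) (ev_mod S)).
Proof.
split=> [m m' d|m d d'|m l d].
- by rewrite translD; exact: (@tpureDl _ (Hom M) (ev_mod S)).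
- by rewrite (LHomD_add jP); exact: (@tpureDr _ (Hom M) (ev_mod S)).
- rewrite (LHomD_Z jP) [transl _ _]transl_act.
  exact: (@tpureA _ (Hom M) (ev_mod S) _ (lring S l) _).
Qed.

Definition uneval_tens : tensor (indL E M) D -> evt_comod (Hom M) :=
  tlift (fun (m : indL E M) (d : D) =>
    (transl qP (m : M) : Hom M) ⊗ (j d : ev_mod S) : tensor (Hom M) (ev_mod S)).
Definition uneval (m : M) : evt_comod (Hom M) := uneval_tens (ind_coact E m).

Lemma uneval_tensD y y' : uneval_tens (y + y') = uneval_tens y + uneval_tens y'.
Proof. exact: tliftD uneval_balanced y y'. Qed.

Lemma uneval_tensE (m : indL E M) d :
  uneval_tens (m ⊗ d) = (transl qP (m : M) : Hom M) ⊗ (j d : ev_mod S).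
Proof. exact: tlift_pure uneval_balanced. Qed.

Lemma contract_section_balanced :
  tbalanced (tens M (extC E)) D (fun w d => contract q (j d) w).
Proof.
split=> [v w d|w d d'|w l d].
- exact: (contractD qP).
- by rewrite (LHomD_add jP); exact: (proj1 (contract_rlin qP w)).
- rewrite (LHomD_Z jP).
  move: w; apply: (@tensor_ext _ M C _
    (fun w => contract q (j d) ((w : tens M (extC E)) <* l))) => [v w|v w|m c].
  + rewrite [X in contract _ _ X](@tens_ractDl _ _ _ M (extC E)).
    exact: (contractD qP).
  + exact: (contractD qP).
  + rewrite [X in contract _ _ X](@tens_ractE _ _ _ M (extC E)) !(contractE qP).
    by rewrite (Qtilde_bract qP).
Qed.

(** Evaluation of [uneval_tens] only depends on the image in
    M (x)_A C (x)_L D, the place where [ind_coactP] describes the induced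
    coaction. *)
Lemma eval_uneval_tens (y : tensor (indL E M) D) :
  eval (uneval_tens y)
  = tlift (fun (w : tens M (extC E)) d => contract q (j d) w)
      (tmap (coactL E M) id y).
Proof.
have cb := contract_section_balanced.
move: y; apply: tensor_ext => [x y|x y|m d].
- by rewrite uneval_tensD evalD.
- by rewrite tmapD // (tliftD cb).
- by rewrite tmapE // (tlift_pure _ _ cb) uneval_tensE evalE.
Qed.
End Inverse.

Lemma pairing_balanced :
  tbalanced (bright (extC E)) D (fun (c : bright (extC E)) (d : D) => dual_ev (q c) (j d) : A).
Proof.
split=> [c c' d|c d d'|c l d].
- exact: (Qtilde_add qP).
- by rewrite (LHomD_add jP) [LHS]dual_evD.
- by rewrite (LHomD_Z jP) -(Qtilde_bract qP).
Qed.

(** The counit cancels the coaction of S, leaving q(c_[0])(j(c_[1])). *)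
Lemma counit_bullet c :
  counit (bullet E q j c)
  = tlift (fun (c0 : bright (extC E)) (d : D) => dual_ev (q c0) (j d) : A) (tauC (E := E) c).
Proof.
have pb := pairing_balanced; have bb := bullet_balanced qP jP.
rewrite /bullet; move: (tauC c).
apply: (@tensor_ext _ (bright (extC E)) D) => [v w|v w|c0 d].
- by rewrite (tliftD bb) counitD.
- exact: (tliftD pb).
rewrite (tlift_pure _ _ bb) (tlift_pure _ _ pb).
rewrite -[j d in RHS](coact_counit (bc_coact S)).
have cb := @rscale_counit_balanced _ _ C (bright S).
have qb := Qtilde_balancedr (q c0).
move: (bc_coact S (j d)); apply: (@tensor_ext _ (bright S) C) => [v w|v w|x e].
- by rewrite (tliftD qb) counitD.
- by rewrite (tliftD cb) [LHS]dual_evD.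
- by rewrite (tlift_pure _ _ qb) (tlift_pure _ _ cb) counitZ [RHS]dual_ev_bract.
Qed.

Section EvalBijective.
Hypothesis bulletK : forall c, bullet E q j c = c.

(** eval (uneval m) = m^0 q(m^1_[0])(j m^1_[1]) = m^0 eps((q . j)(m^1)) = m. *)
Lemma unevalK (M : comod C) : cancel (@uneval M) (@eval _ _ _ _ S M).
Proof.
move=> m; rewrite /uneval eval_uneval_tens (ind_coactP Epure).
have cb := contract_section_balanced M; have pb := pairing_balanced.
have tl := tauC_llin E.
rewrite -[RHS](coact_counit (comod_coact M)).
have rb := @rscale_counit_balanced _ _ C M.
move: (rho m); apply: (@tensor_ext _ M C) => [v w|v w|m0 c].
- by rewrite tmapD // tassocVD (tliftD cb).
- exact: (tliftD rb).
rewrite (tlift_pure _ _ rb) tmapE // -[in RHS](bulletK c) counit_bullet.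
move: (tauC c); apply: (@tensor_ext _ (bright (extC E)) D _
  (fun t => tlift _ (tassocV (m0 ⊗ (t : ltens (extC E) D))))
  (fun t => m0 <* tlift _ t)) => [v w|v w|c0 d].
- by rewrite [m0 ⊗ _]tpureDr tassocVD (tliftD cb).
- by rewrite (tliftD pb) rscaleDr.
- by rewrite tassocVE (tlift_pure _ _ cb) (tlift_pure _ _ pb) (contractE qP).
Qed.

(** On f (x) x, D-colinearity of f and naturality of [transl] let f be pulled
    out and T-balancedness moves transl x_[0] across the tensor sign; what
    remains is [unevalK] for the comodule S. *)
Lemma evalK (M : comod C) :
  cancel (@eval _ _ _ _ S M) (@uneval M).
Proof.
apply: (@tensor_ext _ (Hom M) (ev_mod S) _
  (fun y => uneval (eval (y : evt_comod (Hom M)))) id) => [x y|//|f x].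
  by rewrite evalD /uneval (ind_coactD Epure) uneval_tensD.
rewrite evalE -[x in RHS](@unevalK (bc_comod S)).
rewrite /uneval (ind_coact_nat Epure).
have fL := chom_indL_rlin E (f : chom (bc_comod S) M).
move: (ind_coact E (x : bc_comod S)); apply: (@tensor_ext _ (indL E (bc_comod S)) D _
  (fun y => uneval_tens (tmap _ id y))
  (fun y => (f : Hom M) ⊗ (eval (uneval_tens y) : ev_mod S))) => [v w|v w|x0 d].
- by rewrite (tmapD fL) // uneval_tensD.
- by rewrite uneval_tensD evalD; exact: (@tpureDr _ (Hom M) (ev_mod S)).
- rewrite (tmapE fL) // !uneval_tensE evalE [transl _ _]transl_nat.
  exact: (@tpureA _ (Hom M) (ev_mod S) f (transl qP x0) (j d)).
Qed.
End EvalBijective.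

Section Generator.
Variables (v : D -> T) (vP : is_LHomL v).

Lemma transl_mul_balanced :
  tbalanced (indL E (bc_comod S)) D (fun (x : indL E (bc_comod S)) (d : D) =>
    (transl qP (x : bc_comod S) : T) * v d).
Proof.
split=> [x x' d|x d d'|x l d].
- by rewrite translD mulrDl.
- by rewrite (LHomL_add vP) mulrDr.
- by rewrite [transl _ _]transl_act (LHomL_Z vP) mulrA.
Qed.

(** For cleft S, t (x) d |-> t(j d) is an isomorphism of left T-modules from
    T (x)_L D to S, with inverse x |-> transl x_[0] (x) x_[1]; through it,
    [to_endo] is the map t (x) d |-> t v(d). *)
Definition to_endo (x : S) : T :=
  tlift (fun (x : indL E (bc_comod S)) (d : D) =>
    (transl qP (x : bc_comod S) : T) * v d) (ind_coact E (x : bc_comod S)).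

Lemma to_endoD x y : to_endo (x + y) = to_endo x + to_endo y.
Proof.
rewrite /to_endo (ind_coactD Epure (M := bc_comod S)).
exact: (tliftD transl_mul_balanced).
Qed.

Lemma to_endoZ (t : T) x : to_endo (t x) = t * to_endo x.
Proof.
have tb := transl_mul_balanced.
have tP := chom_indL_rlin E (t : chom (bc_comod S) (bc_comod S)).
rewrite /to_endo (ind_coact_nat Epure); move: (ind_coact E x).
apply: (@tensor_ext _ (indL E (bc_comod S)) D) => [y z|y z|y d].
- by rewrite (tmapD tP) // (tliftD tb).
- by rewrite (tliftD tb) mulrDr.
- by rewrite (tmapE tP) // !(tlift_pure _ _ tb) [transl _ _]transl_nat mulrA.
Qed.

(** Since j is D-colinear, to_endo (j d) = transl (j d_1) v(d_2), and
    transl (j d_1) is (j <> q)(d_1), that is eps(d_1). *)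
Lemma to_endo_section :
    (forall d y, lozenge j q d y = (lring S (counit d) : T) y) ->
  forall d, to_endo (j d) = v d.
Proof.
move=> jq d; have tb := transl_mul_balanced.
have jL : rlin (j : bright D -> indL E (bc_comod S)).
  by split; [exact: (LHomD_add jP) | exact: (LHomD_bract jP)].
rewrite /to_endo (LHomD_coact jP) -[d in RHS](comul_counitl d).
have cb : tbalanced (bright D) D (fun (d1 : bright D) (d2 : D) => counit d1 *: d2).
  split=> [x y z|x y z|x l z].
  - by rewrite counitD scalerDl.
  - exact: scalerDr.
  - by rewrite [counit _]counit_bract scalerA.
move: (comul D d); apply: (@tensor_ext _ (bright D) D) => [x y|x y|d1 d2].
- by rewrite (tmapD jL) // (tliftD tb).
- by rewrite (tliftD cb) (LHomL_add vP).
rewrite (tmapE jL) // (tlift_pure _ _ tb) (tlift_pure _ _ cb) (LHomL_Z vP).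
by congr (_ * _); apply: chom_ext => y; exact: jq.
Qed.
End Generator.
End CleftBicomodule.

Theorem corollary5p5 (k : comPzRingType) (A L : kalg k) (C : coring A)
    (D : coring L) (E : coring_ext C D) (S : bicomod L C) :
  pure_ext E -> cleft E S ->
  fully_faithful (hom_functor (bc_comod S))
  /\
  ((exists (n : nat) (v : 'I_n -> D -> endo (bc_comod S)) (d : 'I_n -> D),
      (forall i, is_LHomL (v i)) /\ \sum_(i < n) v i (d i) = 1) ->
   inverse_equivalences (evt_functor S) (hom_functor (bc_comod S))).
Proof.
move=> Epure [j [q [jP qP bulletK jq]]].
have evalB (M : comod C) : bijective (@eval _ _ _ _ S M).
  by exists (uneval j qP (M := M)); [exact: evalK | exact: unevalK].
split; first exact: hom_fully_faithful.
move=> [n [v [d [vP vd]]]].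
apply: (generator_equivalence evalB (w := fun i => to_endo qP (v i))
  (s := fun i => j (d i))).
- by move=> i; exact: (to_endoD Epure).
- by move=> i; exact: (to_endoZ Epure).
- rewrite -vd; apply: eq_bigr => i _.
  by rewrite (to_endo_section jP qP).
Qed.
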